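(* Suppose $F\in C(\overline{\mathbb R}^2)$, $f=\partial_{12}F$ and $g\in\mathcal{HKBV}(\overline{\mathbb R}^2)$. For $(x,y)\in\overline{\mathbb R}^2$ define $$\Phi(x,y)=F(x,y)g(x,y)-\int_{-\infty}^xF(s,y)\,d_1g(s,y)-\int_{-\infty}^yF(x,t)\,d_2g(x,t)+\int_{-\infty}^x\int_{-\infty}^yF(s,t)\,d_{12}g(s,t).$$ Then $\Phi\in C(\overline{\mathbb R}^2)$. If $F\in\mathcal B_c(\overline{\mathbb R}^2)$ then $\Phi\in\mathcal B_c(\overline{\mathbb R}^2)$ and $\partial_{12}\Phi\in\mathcal A_c(\mathbb R^2)$.
   Context: $\overline{\mathbb R}=[-\infty,\infty]$ is the two-point compactification of $\mathbb R$, $\overline{\mathbb R}^2$ carries the product topology, and $C(\overline{\mathbb R}^2)$ is the set of continuous real-valued functions on it. $\mathcal B_c(\overline{\mathbb R}^2)=\{F\in C(\overline{\mathbb R}^2)\mid F(-\infty,s)=F(s,-\infty)=0\ \forall s\in\overline{\mathbb R}\}$. $\partial_{12}=\partial_1\partial_2$ is the distributional derivative on $\mathbb R^2$, and $\mathcal A_c(\mathbb R^2)=\{\partial_{12}F\mid F\in\mathcal B_c(\overline{\mathbb R}^2)\}\subset\mathcal D'(\mathbb R^2)$. Hardy--Krause variation: a division of $\overline{\mathbb R}^2$ is a finite collection of closed intervals with union $\overline{\mathbb R}^2$ whose pairwise intersections have planar Lebesgue measure zero. For $g:\overline{\mathbb R}^2\to\mathbb R$, $V_{12}g=\sup\sum_i|g(a_i,c_i)+g(b_i,d_i)-g(a_i,d_i)-g(b_i,c_i)|$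 over all divisions $\{[a_i,b_i]\times[c_i,d_i]\}$ of $\overline{\mathbb R}^2$; $V_1g(\cdot,y_0)$ and $V_2g(x_0,\cdot)$ are the one-variable total variations over $\overline{\mathbb R}$ of $x\mapsto g(x,y_0)$ and $y\mapsto g(x_0,y)$. $\mathcal{HKBV}(\overline{\mathbb R}^2)$ is the set of $g$ with $V_{12}g<\infty$ and, for some $x_0,y_0\in\overline{\mathbb R}$, $V_1g(\cdot,y_0)<\infty$ and $V_2g(x_0,\cdot)<\infty$. Stieltjes integrals are Henstock--Stieltjes integrals: a gauge $\gamma$ assigns to each point an open set containing it (contained in $\mathbb R^2$ for points of $\mathbb R^2$); a tagged division $\{[a_i,b_i]\times[c_i,d_i],(x_i,y_i)\}$ (tag in its interval) is $\gamma$-fine if each interval is contained in $\gamma$ of its tag; $\iint F\,d_{12}g=A$ means for every $\epsilon>0$ there is a gauge $\gamma$ such that $|\sum_iF(x_i,y_i)[g(a_i,c_i)+g(b_i,d_i)-g(a_i,d_i)-g(b_i,c_i)]-A|<\epsilon$ for each $\gamma$-fine tagged division of the interval of integration. $d_1$ and $d_2$ denote the analogous one-variable integrals with respect to the first, resp. second, variable. *)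

(* Defs.v *)
From HB Require Import structures.
From mathcomp Require Import all_boot all_order all_algebra.
From mathcomp Require Import all_classical all_reals all_analysis.
From mathcomp Require Import measurable_realfun.
Import numFieldNormedType.Exports.
Import Order.TTheory GRing.Theory Num.Theory.

Set Implicit Arguments.
Unset Strict Implicit.
Unset Printing Implicit Defensive.

Local Open Scope classical_set_scope.
Local Open Scope ring_scope.

Section divisions.
Variable R : realType.

Notation xR := (\bar R).
Notation xR2 := (\bar R * \bar R)%type.
Notation leb := (@lebesgue_measure R).

(* A pair (a, b) with a <= b encodes [a, b], and (J, K) encodes the product
   of the intervals J and K.  Degenerate intervals are allowed: they contribute
   0 to every sum below, and they make an integral over [-oo, x] meaningful
   (and equal to 0) when x = -oo. *)
Definition itv1 : Type := (xR * xR)%type.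
Definition itv2 : Type := (itv1 * itv1)%type.

Definition segment (J : itv1) : set xR := [set` `[J.1, J.2]].
Definition box (Q : itv2) : set xR2 := segment Q.1 `*` segment Q.2.

Definition whole1 : itv1 := (-oo%E, +oo%E).
Definition whole2 : itv2 := (whole1, whole1).

Definition fin1 (x : R) : xR := x%:E.
Definition fin2 (p : R * R) : xR2 := (p.1%:E, p.2%:E).

(* Lebesgue measure of the finite part of a set of (pairs of) extended reals. *)
Definition null1 (A : set xR) : Prop := leb (fin1 @^-1` A) = 0%E.
Definition null2 (A : set xR2) : Prop := (leb \x leb)%E (fin2 @^-1` A) = 0%E.

Definition division1 (I : itv1) (n : nat) (J : 'I_n -> itv1) : Prop :=
  [/\ forall i, ((J i).1 <= (J i).2)%E,
      \bigcup_i segment (J i) = segment I &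
      forall i j, i != j -> null1 (segment (J i) `&` segment (J j))].

Definition division2 (I : itv2) (n : nat) (Q : 'I_n -> itv2) : Prop :=
  [/\ forall i, ((Q i).1.1 <= (Q i).1.2)%E /\ ((Q i).2.1 <= (Q i).2.2)%E,
      \bigcup_i box (Q i) = box I &
      forall i j, i != j -> null2 (box (Q i) `&` box (Q j))].

Definition gauge1 (gam : xR -> set xR) : Prop :=
  forall x, [/\ open (gam x), gam x x &
                range fin1 x -> gam x `<=` range fin1].

Definition gauge2 (gam : xR2 -> set xR2) : Prop :=
  forall z, [/\ open (gam z), gam z z &
                range fin2 z -> gam z `<=` range fin2].

Definition fine1 (gam : xR -> set xR) n (J : 'I_n -> itv1) (t : 'I_n -> xR) :=
  forall i, segment (J i) (t i) /\ segment (J i) `<=` gam (t i).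

Definition fine2 (gam : xR2 -> set xR2) n (Q : 'I_n -> itv2) (t : 'I_n -> xR2) :=
  forall i, box (Q i) (t i) /\ box (Q i) `<=` gam (t i).

Definition incr1 (h : xR -> R) (J : itv1) : R := h J.2 - h J.1.

Definition incr2 (g : xR2 -> R) (Q : itv2) : R :=
  let: ((a, b), (c, d)) := Q in g (a, c) + g (b, d) - g (a, d) - g (b, c).

Definition var1 (h : xR -> R) : \bar R :=
  ereal_sup [set v | exists n (J : 'I_n -> itv1),
    division1 whole1 J /\ v = (\sum_(i < n) `|incr1 h (J i)|)%:E].

Definition var12 (g : xR2 -> R) : \bar R :=
  ereal_sup [set v | exists n (Q : 'I_n -> itv2),
    division2 whole2 Q /\ v = (\sum_(i < n) `|incr2 g (Q i)|)%:E].

Definition HKBV : set (xR2 -> R) := [set g |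
  (var12 g < +oo)%E /\
  exists x0 y0, (var1 (fun x => g (x, y0)) < +oo)%E /\
                (var1 (fun y => g (x0, y)) < +oo)%E].

Definition is_HS1 (I : itv1) (F h : xR -> R) (A : R) : Prop :=
  forall eps : R, 0 < eps -> exists2 gam, gauge1 gam &
    forall n (J : 'I_n -> itv1) (t : 'I_n -> xR),
      division1 I J -> fine1 gam J t ->
      `|\sum_(i < n) F (t i) * incr1 h (J i) - A| < eps.

Definition is_HS2 (I : itv2) (F g : xR2 -> R) (A : R) : Prop :=
  forall eps : R, 0 < eps -> exists2 gam, gauge2 gam &
    forall n (Q : 'I_n -> itv2) (t : 'I_n -> xR2),
      division2 I Q -> fine2 gam Q t ->
      `|\sum_(i < n) F (t i) * incr2 g (Q i) - A| < eps.

Definition HS1_integrable I F h := exists A, is_HS1 I F h A.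
Definition HS2_integrable I F g := exists A, is_HS2 I F g A.

(* [get] returns an unspecified real when the integral does not exist, so these
   are meaningful only together with the integrability predicates above. *)
Definition HS1 I F h : R := get (is_HS1 I F h).
Definition HS2 I F g : R := get (is_HS2 I F g).

Definition Bc : set (xR2 -> R) := [set F |
  continuous F /\ forall s : xR, F (-oo%E, s) = 0 /\ F (s, -oo%E) = 0].

Definition Phi (F g : xR2 -> R) (z : xR2) : R :=
  let: (x, y) := z in
  F (x, y) * g (x, y)
  - HS1 (-oo%E, x) (fun s => F (s, y)) (fun s => g (s, y))
  - HS1 (-oo%E, y) (fun t => F (x, t)) (fun t => g (x, t))
  + HS2 ((-oo%E, x), (-oo%E, y)) F g.

End divisions.

Section distributions.
Variable R : realType.
Notation leb := (@lebesgue_measure R).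

Inductive axis := axis1 | axis2.

Definition dir (i : axis) : R * R :=
  match i with axis1 => (1, 0) | axis2 => (0, 1) end.

Definition partial (i : axis) (phi : R * R -> R) : R * R -> R :=
  fun p => 'D_(dir i) phi p.

(* [iter_partial [:: i1; ...; ik] phi] is d_i1 (... (d_ik phi)). *)
Definition iter_partial (w : seq axis) (phi : R * R -> R) : R * R -> R :=
  foldr partial phi w.

Definition smooth (phi : R * R -> R) : Prop :=
  forall w, continuous (iter_partial w phi) /\
            forall i p, derivable (iter_partial w phi) p (dir i).

Definition supp (phi : R * R -> R) : set (R * R) :=
  closure [set p | phi p != 0].

Record test := Test {
  test_fun :> R * R -> R ;
  test_smooth : smooth test_fun ;
  test_supp : compact (supp test_fun) }.

Lemma smooth_partial i phi : smooth phi -> smooth (partial i phi).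
Proof.
move=> sphi w; rewrite /iter_partial -[partial i phi]/(foldr partial phi [:: i]).
by rewrite -foldr_cat; exact: sphi.
Qed.

Lemma supp_partial i phi : supp (partial i phi) `<=` supp phi.
Proof.
rewrite {1}/supp closureE => p; apply; split; first exact: closed_closure.
move=> q /= dq; apply: contrapT => nq; move/eqP: dq; apply.
have : nbhs q (~` supp phi).
  by apply: open_nbhs_nbhs; split => //; exact/closed_openC/closed_closure.
move=> nbq; rewrite /partial (near_eq_derive (g := cst 0)) ?derive_cst //=.
near=> r; have : (~` supp phi) r by near: r.
move=> /= nr; apply: contrapT => /eqP phir; apply: nr.
exact: subset_closure.
Unshelve. all: by end_near. Qed.

Lemma compact_supp_partial i phi :
  compact (supp phi) -> compact (supp (partial i phi)).
Proof.
move=> cphi; apply: subclosed_compact cphi _; first exact: closed_closure.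
exact: supp_partial.
Qed.

Definition test_partial (i : axis) (phi : test) : test :=
  Test (smooth_partial i (test_smooth phi))
       (@compact_supp_partial i _ (@test_supp phi)).

Definition test_cvg (u : nat -> test) (phi : test) : Prop :=
  (exists2 K, compact K & forall n, supp (u n) `<=` K) /\
  forall w (eps : R), 0 < eps -> \forall n \near \oo, forall p,
    `|iter_partial w (u n) p - iter_partial w phi p| < eps.

Definition functional : Type := test -> R.

(* Linearity is stated relationally: [chi] is the test function
   [a *: phi + psi]. *)
Definition distribution : set functional := [set T |
  (forall (a : R) (phi psi chi : test),
     (forall p, chi p = a * phi p + psi p) -> T chi = a * T phi + T psi) /\
  (forall u phi, test_cvg u phi -> T (u n) @[n --> \oo] --> T phi)].

Definition dpartial (i : axis) (T : functional) : functional :=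
  fun phi => - T (test_partial i phi).

(* The distribution on R^2 induced by a function on the extended plane. *)
Definition regular (F : \bar R * \bar R -> R) : functional :=
  fun phi => (\int[(leb \x leb)%E]_p (F (fin2 p) * phi p))%R.

Definition d12 (F : \bar R * \bar R -> R) : functional :=
  dpartial axis1 (dpartial axis2 (regular F)).

Definition Ac : set functional := [set d12 F | F in @Bc R].

End distributions.

Section distribution_theory.
Variable R : realType.
Notation leb := (@lebesgue_measure R).
Notation leb2 := (leb \x leb)%E.
Notation mR2 := (measurableTypeR R * measurableTypeR R)%type.

Lemma open_measurable2 (U : set (R * R)) : open U -> measurable (U : set mR2).
Proof.
move=> oU.
pose S := [set q : (rat * rat) * (rat * rat) |
  ball (@ratr R q.1.1) (ratr q.1.2) `*` ball (@ratr R q.2.1) (ratr q.2.2)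
  `<=` U].
have -> : U = \bigcup_(q in S)
  (ball (@ratr R q.1.1) (ratr q.1.2) `*` ball (@ratr R q.2.1) (ratr q.2.2)).
  rewrite eqEsubset; split => [p Up|p [q /= Sq /Sq]//].
  have /nbhs_ballP[e /= e0 peU] : nbhs p U by exact: open_nbhs_nbhs.
  have rat_ball (x : R) : exists c r, ball (@ratr R c) (ratr r) x /\
      ball (@ratr R c) (ratr r) `<=` ball x e.
    have xb : x \in (ball x e : set R) by rewrite inE; exact: ballxx.
    have [c [r [/set_mem ? ?]]] := open_subball_rat (ball_open x e) xb.
    by exists c, r.
  have [c1 [r1 [x1 s1]]] := rat_ball p.1.
  have [c2 [r2 [x2 s2]]] := rat_ball p.2.
  exists ((c1, r1), (c2, r2)) => //= t [/= t1 t2].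
  by apply: peU; split; [exact: s1|exact: s2].
rewrite bigcup_mkcond; apply: countable_bigcupT_measurable => [//|q].
by case: ifPn => // _; apply: measurableX; apply: open_measurable; exact: ball_open.
Qed.

Lemma continuous_measurable_fun2 (f : R * R -> R) :
  continuous f -> measurable_fun setT (f : mR2 -> R).
Proof.
move=> /continuousP cf; apply: (measurability _ (RGenOpens.measurableE R)).
move=> _ [_ [a [b ->] <-]]; rewrite setTI; apply: open_measurable2.
exact/cf/interval_open.
Qed.

Definition square (M : R) : set (R * R) := `[-M, M] `*` `[-M, M].

Lemma square_measurable M : measurable (square M : set mR2).
Proof. by apply: measurableX; exact: measurable_itv. Qed.

Lemma square_compact M : compact (square M).
Proof. by apply: compact_setX; exact: segment_compact. Qed.

Lemma square_fin M : (leb2 (square M) < +oo)%E.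
Proof.
rewrite product_measure1E ?measurable_itv//=.
by rewrite lebesgue_measure_itv/=; case: ifP => _; rewrite ?mul0e// -EFinD -EFinM ltry.
Qed.

Lemma compact_square (K : set (R * R)) : compact K ->
  exists M, K `<=` square M.
Proof.
move=> /compact_bounded[M [_ KM]]; exists (M + 1) => p Kp.
have : `|p| <= M + 1 by apply: KM => //; rewrite ltrDl.
rewrite prod_normE ge_max => /andP[p1 p2].
by split; rewrite /= in_itv/= -ler_norml.
Qed.

Lemma continuous_square_bounded (f : R * R -> R) M : continuous f ->
  exists2 C, 0 <= C & forall p, square M p -> `|f p| <= C.
Proof.
move=> cf.
have /compact_bounded[C [_ KC]] : compact (f @` square M).
  apply: continuous_compact; last exact: square_compact.
  exact: continuous_subspaceT.
exists (`|C| + 1) => [|p sp]; first by rewrite addr_ge0.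
by apply: KC; [rewrite (le_lt_trans (ler_norm _))// ltrDl|exists p].
Qed.

Lemma continuous_fin2 : continuous (@fin2 R).
Proof.
move=> [x y] P [[A B] /= [xA yB] ABP].
exists (@fin1 R @^-1` A, @fin1 R @^-1` B); first by split => /=; apply/nbhs_EFin.
by move=> [s t] [/= As Bt]; exact: (ABP (_, _)).
Qed.

Lemma test_continuous (phi : test R) : continuous phi.
Proof. exact: (test_smooth phi [::]).1. Qed.

Lemma supp_square (phi : R * R -> R) M : supp phi `<=` square M ->
  forall p, ~ square M p -> phi p = 0.
Proof.
move=> sM p nsp; apply: contrapT => /eqP phip; apply: nsp; apply: sM.
exact: subset_closure.
Qed.

Section with_density.
Variable f : R * R -> R.
Hypothesis cf : continuous f.

Lemma continuous_mul_test (phi : test R) : continuous (fun p => f p * phi p).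
Proof. by move=> p; apply: cvgM; [exact: cf|exact: test_continuous]. Qed.

Lemma integrable_mul_test (phi : test R) :
  leb2.-integrable setT (EFin \o (fun p => f p * phi p)).
Proof.
have [M sM] := compact_square (@test_supp _ phi).
have cfp := @continuous_mul_test phi.
have -> : EFin \o (fun p => f p * phi p) =
    (EFin \o (fun p => f p * phi p)) \_ (square M).
  apply/funext => p; rewrite patchE; case: ifPn => // /negP nsp.
  by rewrite /= (supp_square sM) ?mulr0// => sp; apply: nsp; rewrite inE.
have mS := square_measurable M.
apply: (@integrable_mkcond _ mR2 R leb2 _ (EFin \o (fun p => f p * phi p)) mS).1.
apply: measurable_bounded_integrable => //; first exact: square_fin.
  by apply: measurable_funTS; exact: continuous_measurable_fun2.
have [C C0 fC] := continuous_square_bounded M cfp.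
exists C; split; first exact: num_real.
by move=> x Cx p sp /=; exact: le_trans (fC _ sp) (ltW Cx).
Qed.

End with_density.

Lemma regular_distribution (F : \bar R * \bar R -> R) :
  continuous F -> distribution (regular F).
Proof.
move=> cF; pose f := F \o @fin2 R.
have cf : continuous f.
  by move=> p; apply: continuous_comp; [exact: continuous_fin2|exact: cF].
split=> [a phi psi chi E|u phi [[K cK uK] uphi]].
  rewrite /regular.
  have -> : (fun p => F (fin2 p) * chi p) =
      (fun p => a * (f p * phi p) + f p * psi p).
    by apply/funext => p; rewrite E mulrDr mulrCA.
  have iphi := integrable_mul_test cf phi.
  have ipsi := integrable_mul_test cf psi.
  rewrite RintegralD//; last exact: (integrableZl _ a iphi).
  by rewrite RintegralZl.
have [M1 KM] := compact_square cK.
have [M2 phiM] := compact_square (@test_supp _ phi).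
pose M := Num.max M1 M2.
have subM N : N <= M -> square N `<=` square M.
  move=> NM p [/=]; rewrite !in_itv/= -!ler_norml => p1 p2.
  by split; rewrite /= in_itv/= -ler_norml; exact: le_trans NM.
have u0 n p : ~ square M p -> u n p = 0.
  apply: (@supp_square (u n)) => q /uK /KM.
  by apply: subM; rewrite le_max lexx.
have phi0 p : ~ square M p -> phi p = 0.
  apply: supp_square; apply: (subset_trans phiM).
  by apply: subM; rewrite le_max lexx orbT.
have [C C0 fC] := continuous_square_bounded M cf.
pose m := fine (leb2 (square M)).
have m0 : 0 <= m by rewrite fine_ge0.
have mS := square_measurable M.
apply/cvgrPdist_le => e e0.
have d0 : 0 < e / (C * m + 1) by rewrite divr_gt0// ltr_wpDl// mulr_ge0.
near=> n.
have und p : `|phi p - u n p| <= e / (C * m + 1).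
  rewrite distrC ltW//; move: p; near: n.
  exact: (uphi [::] _ d0).
have iphi := integrable_mul_test cf phi.
have iu := integrable_mul_test cf (u n).
rewrite /regular -RintegralB//.
have -> : (fun p => F (fin2 p) * phi p - F (fin2 p) * u n p) =
    (fun p => f p * (phi p - u n p)) \_ (square M).
  apply/funext => p; rewrite patchE; case: ifPn => [_|/negP nM].
    by rewrite -mulrBr.
  have nMp : ~ square M p by move=> Mp; apply: nM; rewrite inE.
  by rewrite u0// phi0// !mulr0 subr0.
rewrite -Rintegral_mkcond.
have iB : leb2.-integrable (square M) (EFin \o (fun p => f p * (phi p - u n p))).
  rewrite (_ : _ \o _ =
    (fun p => (f p * phi p)%:E - (f p * u n p)%:E)%E); last first.
    by apply/funext => p /=; rewrite mulrBr EFinB.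
  apply: (integrableB mS).
    exact: (integrableS measurableT mS _ iphi).
  exact: (integrableS measurableT mS _ iu).
apply: le_trans (le_normr_Rintegral mS iB) _.
apply: (@le_trans _ _ (\int[leb2]_(p in square M) (C * (e / (C * m + 1))))).
  apply: le_Rintegral => //.
  - exact: (integrable_norm iB).
  - apply/integrableP; split; first exact: measurable_cst.
    by rewrite integral_cst// lte_mul_pinfty// square_fin.
  - by move=> p Mp; rewrite normrM ler_pM// fC.
rewrite Rintegral_cst// -/m.
rewrite mulrAC mulrCA ger_pMr// ler_pdivrMr ?mul1r ?lerDl//.
by rewrite ltr_wpDl// mulr_ge0.
Unshelve. all: by end_near. Qed.

Lemma dpartial_distribution i (T : functional R) :
  distribution T -> distribution (dpartial i T).
Proof.
move=> [linT cT]; split=> [a phi psi chi E|u phi [[K cK uK] uphi]].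
  rewrite /dpartial (linT a (test_partial i phi) (test_partial i psi)).
    by rewrite opprD mulrN.
  move=> p /=; rewrite /partial.
  have -> : test_fun chi = a *: test_fun phi + test_fun psi.
    by apply/funext => q; rewrite E.
  have dphi : derivable phi p (dir R i) by exact: (test_smooth phi [::]).2.
  have dpsi : derivable psi p (dir R i) by exact: (test_smooth psi [::]).2.
  by rewrite deriveD ?deriveZ//; exact: derivableZ.
apply: cvgN; apply: cT; split.
  by exists K => // n; apply: subset_trans (uK n); exact: supp_partial.
move=> w e e0; apply: filterS (uphi (rcons w i) e e0) => n un p.
have iterE (v : test R) :
    iter_partial w (test_partial i v) = iter_partial (rcons w i) v.
  by rewrite /iter_partial foldr_rcons.
by rewrite !iterE; exact: un.
Qed.

Lemma Ac_distribution : @Ac R `<=` @distribution R.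
Proof.
move=> _ [F [cF _] <-]; do 2 apply: dpartial_distribution.
exact: regular_distribution.
Qed.

End distribution_theory.

(* Main.v *)
Require Import Defs.
From mathcomp Require Import all_boot all_order all_algebra.
From mathcomp Require Import all_classical all_reals all_analysis.
From mathcomp Require Import measurable_realfun ring lra.
Import numFieldNormedType.Exports.
Import Order.TTheory GRing.Theory Num.Theory.
Set Implicit Arguments.
Unset Strict Implicit.
Unset Printing Implicit Defensive.
Local Open Scope classical_set_scope.
Local Open Scope ring_scope.

(** Freezing the first variable of [F] at [x] turns [F] into a function of
    [t] alone, and for such a function the four terms of [Phi] telescope to an
    expression in which [x] does not occur.  Hence, with
    G (s, t) = F (s, t) - F (x, t) and x <= x',
<<
      Phi (x', y) - Phi (x, y)
        = (F (x', y) - F (x, y)) g (x', y) - int_x^x' G (s, y) d_1 g (s, y)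
          - int_-oo^y G (x', t) d_2 g (x', t)
          + int_x^x' int_-oo^y G d_12 g,
>>
    and every term is at most the oscillation of [F] over [x, x'] times a
    bound on [g] and its variations ([Phi_increment]).  By compactness this
    oscillation is small for x' near x, uniformly in the second variable, so
    [Phi] is continuous in [x] uniformly in [y] ([near_Phi1]).  Exchanging the
    two variables exchanges the roles of [x] and [y] ([Phi_swap]), and joint
    continuity follows.  When [F] is in [Bc] and one coordinate is -oo, every
    term of [Phi] vanishes: its factor or integrand [F] is zero, or its domain
    is degenerate.

    The Stieltjes integrals are handled on the line and on the plane at once,
    as limits of Riemann sums along the filter of fine tagged divisions.  The
    facts used about this filter are the following.
    - The half-open cells of a division partition the half-open domain
      ([tiling_hop]); so increments of an arbitrary function are additive over
      arbitrary divisions ([incr1_additive], [incr2_additive]), by cutting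
      along a grid that contains all endpoints.
    - The filter is proper, which is Cousin's lemma ([cousin_line],
      [cousin_plane]).  In the plane it follows by slicing into strips: for
      each [t] a fine division of the first factor works for all [t'] in a
      neighbourhood of [t], by compactness of its cells ([strip_gauge]).
    - Two Riemann sums of a continuous function over fine divisions are
      compared on the division formed by the intersections of their cells
      ([riemann_close]), so the sums are Cauchy and the integral exists.
    - The same strips show that the integral over a rectangle of a function of
      [t] alone is a one-variable integral ([is_integral_snd]), the form of
      Fubini's theorem needed to see [x] disappear. *)

(** * Cells and their divisions *)

(** What the theory of divisions uses about closed intervals and closed
    rectangles.  [hop Q] is the half-open part of the cell [Q], made of the
    points that are strictly above its lower ends: up to a thin set it is [Q],
    but the half-open parts of the cells of a division are exactly disjoint.
    [hop_approach] says that a point of [hop I] is approached from below by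
    points of [I] that meet, among finitely many given cells, only those whose
    half-open part contains the limit.  [meet Q Q'] stands for the
    intersection, replaced by some degenerate cell when that is empty. *)
Structure geometry := Geometry {
  gpoint : topologicalType ;
  finite_points : set gpoint ;
  cell : Type ;
  ok : cell -> Prop ;
  pts : cell -> set gpoint ;
  thin : set gpoint -> Prop ;
  hop : cell -> gpoint -> bool ;
  meet : cell -> cell -> cell ;
  finite_points_open : open finite_points ;
  hop_pts : forall Q z, hop Q z -> pts Q z ;
  hop_sub : forall Q I z, ok Q -> pts Q `<=` pts I -> hop Q z -> hop I z ;
  hop_approach : forall (T : finType) (Q : T -> cell) I z, hop I z ->
    exists2 w, pts I w & forall i, pts (Q i) w -> hop (Q i) z ;
  thinP : forall Q Q',
    thin (pts Q `&` pts Q') <-> forall z, ~~ (hop Q z && hop Q' z) ;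
  ok_meet : forall Q Q', ok (meet Q Q') ;
  hop_meet : forall Q Q' z, hop (meet Q Q') z = hop Q z && hop Q' z ;
  pts_meet : forall Q Q', pts Q `&` pts Q' `<=` pts (meet Q Q') ;
  meet_sub : forall Q Q' I, ok Q -> ok Q' -> pts Q `<=` pts I ->
    pts Q' `<=` pts I -> pts (meet Q Q') `<=` pts I }.

Section tilings.
Variables (R : realType) (G : geometry).
Implicit Types (I Q : cell G) (w : cell G -> R) (F : gpoint G -> R).

Definition tiling (T : finType) I (Q : T -> cell G) : Prop :=
  [/\ forall i, ok (Q i), \bigcup_i pts (Q i) = pts I &
      forall i j, i != j -> thin (pts (Q i) `&` pts (Q j))].

Lemma tiling_sub (T : finType) I (Q : T -> cell G) i :
  tiling I Q -> pts (Q i) `<=` pts I.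
Proof. by move=> [_ <- _] z Qz; exists i. Qed.

(** Covering by closed cells gives a cell for a point slightly below [z], and
    such a cell has [z] in its half-open part; thinness of the overlaps makes
    this cell unique. *)
Lemma tiling_hop (T : finType) I (Q : T -> cell G) z :
  tiling I Q -> (\sum_i hop (Q i) z = hop I z)%N.
Proof.
move=> tQ; have [okQ cQ thQ] := tQ.
have QI i : hop (Q i) z -> hop I z.
  by apply: hop_sub => //; exact: tiling_sub tQ.
case: (boolP (hop I z)) => [Iz|/negP nIz]; last first.
  by rewrite big1// => i _; case: (boolP (hop _ _)) => // /QI.
have [v Iv vQ] := hop_approach Q Iz.
move: Iv; rewrite -cQ => -[i _ Qiv]; rewrite (bigD1 i)//= (vQ _ Qiv).
rewrite big1 ?addn0// => j ji; apply/eqP; rewrite eqb0.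
have /thinP/(_ z) := thQ _ _ ji.
by rewrite (vQ _ Qiv) andbT.
Qed.

(** Additivity is asked from the counting identity alone, so that it applies
    to the family of the intersections of a fixed cell with the cells of a
    division, some of which are placeholders for an empty intersection. *)
Definition cell_additive w := forall (T : finType) I (Q : T -> cell G),
  (forall i, ok (Q i)) -> ok I -> (forall z, \sum_i hop (Q i) z = hop I z)%N ->
  \sum_i w (Q i) = w I.

Lemma additive_tiling w (T : finType) I (Q : T -> cell G) :
  cell_additive w -> ok I -> tiling I Q -> \sum_i w (Q i) = w I.
Proof. by move=> aw oI tQ; apply: aw => // [|z]; [case: tQ|exact: tiling_hop]. Qed.

(** For such a cell the empty family satisfies the counting identity. *)
Lemma additive_empty w I :
  cell_additive w -> ok I -> (forall z, ~~ hop I z) -> w I = 0.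
Proof.
move=> aw oI nI; rewrite -(aw 'I_0 I (fun=> I))//; first by rewrite big_ord0.
by move=> z; rewrite big_ord0 (negbTE (nI z)).
Qed.

Lemma tiling_single I : ok I -> tiling I (fun _ : 'I_1 => I).
Proof.
move=> oI; split=> // [|i j]; last by rewrite !ord1.
by apply/seteqP; split=> z; [case|exists ord0].
Qed.

Definition adjoin I1 I2 I := pts I1 `|` pts I2 = pts I /\
  forall z, ~~ (hop I1 z && hop I2 z).

Lemma adjoin_sym I1 I2 I : adjoin I1 I2 I -> adjoin I2 I1 I.
Proof. by move=> [c d]; split=> [|z]; [rewrite setUC|rewrite andbC; exact: d]. Qed.

Lemma tiling_sum (T1 T2 : finType) I1 I2 I (Q1 : T1 -> cell G)
    (Q2 : T2 -> cell G) : adjoin I1 I2 I -> tiling I1 Q1 -> tiling I2 Q2 ->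
  tiling I (fun i : T1 + T2 => match i with inl i => Q1 i | inr i => Q2 i end).
Proof.
move=> [cI dI] t1 t2; have [ok1 c1 th1] := t1; have [ok2 c2 th2] := t2.
have th12 i j : thin (pts (Q1 i) `&` pts (Q2 j)).
  apply/thinP => z; apply/negP => /andP[z1 z2]; have /negP := dI z; apply.
  by rewrite (hop_sub (ok1 i) (tiling_sub t1) z1) (hop_sub (ok2 j) (tiling_sub t2) z2).
split=> [[]//| |].
  rewrite -cI -c1 -c2; apply/seteqP; split=> [z [[i|i] _ iz]|z [[i _ iz]|[i _ iz]]].
  - by left; exists i.
  - by right; exists i.
  - by exists (inl i).
  - by exists (inr i).
move=> [i|i] [j|j] ij //; [exact: th1|rewrite setIC|exact: th2]; exact: th12.
Qed.

Lemma tiling_meet (S T : finType) I (P : S -> cell G) (Q : T -> cell G) :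
  tiling I P -> tiling I Q ->
  tiling I (fun ij : S * T => meet (P ij.1) (Q ij.2)).
Proof.
move=> tP tQ; have [okP cP thP] := tP; have [okQ cQ thQ] := tQ.
split=> [ij| |[i j] [k l] ne]; first exact: ok_meet.
  apply/seteqP; split=> [z [[i j] _]|z Iz].
    apply: meet_sub => //; exact: tiling_sub.
  have [i _ iz] : (\bigcup_i pts (P i)) z by rewrite cP.
  have [j _ jz] : (\bigcup_i pts (Q i)) z by rewrite cQ.
  by exists (i, j) => //; exact: pts_meet.
apply/thinP => z; rewrite /= !hop_meet; apply/negP => /andP[/andP[iz jz] /andP[kz lz]].
move: ne; rewrite xpair_eqE negb_and => /orP[/thP|/thQ] /thinP/(_ z).
  by rewrite iz kz.
by rewrite jz lz.
Qed.

(** * The filter of fine tagged divisions *)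

Definition gauge (gam : gpoint G -> set (gpoint G)) : Prop :=
  forall x, [/\ open (gam x), gam x x &
                @finite_points G x -> gam x `<=` @finite_points G].

Definition fine_for gam (T : finType) (Q : T -> cell G) (t : T -> gpoint G) :=
  forall i, pts (Q i) (t i) /\ pts (Q i) `<=` gam (t i).

Record tagged_division := TaggedDivision {
  dsize : nat ; dcell : 'I_dsize -> cell G ; dtag : 'I_dsize -> gpoint G }.
Arguments dcell : clear implicits.
Arguments dtag : clear implicits.

Definition tag_family (T : finType) (Q : T -> cell G) (t : T -> gpoint G) :=
  @TaggedDivision #|T| (fun i => Q (enum_val i)) (fun i => t (enum_val i)).

Lemma tiling_enum (T : finType) I (Q : T -> cell G) :
  tiling I Q -> tiling I (fun i : 'I_#|T| => Q (enum_val i)).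
Proof.
move=> [okQ cQ thQ]; split=> /= [i| |i j ij]; first exact: okQ.
  rewrite -cQ; apply/seteqP; split=> z [i _ iz]; first by exists (enum_val i).
  by exists (enum_rank i) => //; rewrite enum_rankK.
by apply: thQ; rewrite (inj_eq enum_val_inj).
Qed.

Lemma tiling_tag_family (T : finType) I (Q : T -> cell G) t :
  tiling I Q -> tiling I (dcell (tag_family Q t)).
Proof. exact: tiling_enum. Qed.

Lemma fine_tag_family gam (T : finType) (Q : T -> cell G) t : fine_for gam Q t ->
  fine_for gam (dcell (tag_family Q t)) (dtag (tag_family Q t)).
Proof. by move=> fQ i; exact: fQ. Qed.

Lemma sum_tag_family (T : finType) (Q : T -> cell G) t
    (k : gpoint G -> cell G -> R) :
  \sum_i k (dtag (tag_family Q t) i) (dcell (tag_family Q t) i) =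
  \sum_i k (t i) (Q i).
Proof. by rewrite [RHS](reindex _ (onW_bij _ (@enum_val_bij T))). Qed.

Definition riemann F w (P : tagged_division) := \sum_i F (dtag P i) * w (dcell P i).

(** Statements that hold for all tagged divisions fine for some gauge: the
    integral is a limit along this filter. *)
Definition fine_divisions I : set_system tagged_division := [set B | exists2 gam,
  gauge gam & forall P, tiling I (dcell P) -> fine_for gam (dcell P) (dtag P) -> B P].

Definition is_integral I F w (A : R) :=
  riemann F w P @[P --> fine_divisions I] --> A.

Global Instance fine_divisions_filter I : Filter (fine_divisions I).
Proof.
split.
- exists (fun x => [set y | @finite_points G x -> @finite_points G y]) => // x.
  split=> //; last by move=> fx y /(_ fx).
  case: (pselect (@finite_points G x)) => fx.
    rewrite (_ : [set y | _] = @finite_points G); first exact: finite_points_open.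
    by apply/seteqP; split=> y //= /(_ fx).
  rewrite (_ : [set y | _] = setT); first exact: openT.
  by rewrite -subTset => y _ /fx.
- move=> A B [g1 G1 A1] [g2 G2 B2]; exists (fun x => g1 x `&` g2 x).
    move=> x; have [op1 x1 f1] := G1 x; have [op2 x2 f2] := G2 x.
    split; [exact: openI|by []|by move=> fx y [y1 _]; exact: f1].
  move=> P tP fP; split; [apply: A1 => // i|apply: B2 => // i].
    by have [ti si] := fP i; split=> // z /si[].
    by have [ti si] := fP i; split=> // z /si[].
- by move=> A B AB [g gg Ag]; exists g => // P tP fP; apply/AB/Ag.
Qed.

(** The gauge is arbitrary here, because Cousin's lemma is also applied to
    coverings by neighbourhoods that are not gauges. *)
Definition has_fine gam I :=
  exists P, tiling I (dcell P) /\ fine_for gam (dcell P) (dtag P).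

Lemma has_fine_family gam (T : finType) I (Q : T -> cell G) t :
  tiling I Q -> fine_for gam Q t -> has_fine gam I.
Proof.
move=> tQ fQ; exists (tag_family Q t); split; first exact: tiling_tag_family.
exact: fine_tag_family.
Qed.

Lemma has_fine_single gam I z :
  ok I -> pts I z -> pts I `<=` gam z -> has_fine gam I.
Proof.
by move=> oI Iz Ig; apply: has_fine_family (tiling_single oI) (_ : fine_for _ _ (fun=> z)).
Qed.

Lemma has_fine_adjoin gam I1 I2 I : adjoin I1 I2 I ->
  has_fine gam I1 -> has_fine gam I2 -> has_fine gam I.
Proof.
move=> aI [P1 [tP1 fP1]] [P2 [tP2 fP2]].
apply: has_fine_family (tiling_sum aI tP1 tP2) (_ : fine_for _ _
  (fun i => match i with inl i => dtag P1 i | inr i => dtag P2 i end)).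
by case=> i; [exact: fP1|exact: fP2].
Qed.

Definition cousin := forall I, ok I -> forall gam, gauge gam -> has_fine gam I.

Lemma near_division I (A : set tagged_division) :
  (forall P, tiling I (dcell P) -> (forall i, pts (dcell P i) (dtag P i)) -> A P) ->
  fine_divisions I A.
Proof.
have [g gg _] := @filterT _ _ (fine_divisions_filter I).
by move=> h; exists g => // P tP fP; apply: h => // i; have [] := fP i.
Qed.

Definition oscillation_lt F (d : R) (P : tagged_division) :=
  forall i z, pts (dcell P i) z -> `|F z - F (dtag P i)| < d.

(** The gauge collects, at each point, the points where [F] differs from its
    value there by less than [d]; no uniform continuity is involved, since
    a fine cell lies in the gauge set of its own tag. *)
Lemma near_oscillation I F d : continuous F -> 0 < d ->
  fine_divisions I (oscillation_lt F d).
Proof.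
move=> cF d0.
have [g gg _] := @filterT _ _ (fine_divisions_filter I).
exists (fun x => g x `&` F @^-1` ball (F x) d).
  move=> x; have [ogx gxx fx] := gg x; split.
  - apply: openI => //; apply: open_comp => [y _|]; first exact: cF.
    exact: ball_open.
  - by split=> //; exact: ballxx.
  - by move=> ffx y [gy _]; exact: fx.
move=> P tP fP i z Pz; have [_ /(_ _ Pz)[_]] := fP i.
by rewrite /= -ball_normE /= distrC.
Qed.

Section with_cousin.
Hypothesis csn : cousin.

Lemma fine_divisions_proper I : ok I -> ProperFilter (fine_divisions I).
Proof.
move=> oI; split; last exact: fine_divisions_filter.
move=> [g gg h]; have [P [tP fP]] := csn oI gg; exact: h tP fP.
Qed.

Lemma is_integral_unique I F w A B : ok I ->
  is_integral I F w A -> is_integral I F w B -> A = B.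
Proof.
move=> oI; have := fine_divisions_proper oI => PF.
exact: (@cvg_unique _ (@norm_hausdorff _ _) (riemann F w @ fine_divisions I)).
Qed.

Lemma is_integralD I F F' w A B : is_integral I F w A ->
  is_integral I F' w B -> is_integral I (fun z => F z + F' z) w (A + B).
Proof.
move=> hA hB; rewrite /is_integral.
rewrite (_ : (fun P => _) = (fun P => riemann F w P + riemann F' w P)).
  exact: cvgD.
by apply/funext => P; rewrite /riemann -big_split/=; apply: eq_bigr => i _; rewrite mulrDl.
Qed.

Lemma is_integralB_weight I F w w' A B : is_integral I F w A ->
  is_integral I F w' B -> is_integral I F (fun Q => w Q - w' Q) (A - B).
Proof.
move=> hA hB; rewrite /is_integral.
rewrite (_ : (fun P => _) = (fun P => riemann F w P - riemann F w' P)).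
  exact: cvgB.
by apply/funext => P; rewrite /riemann -sumrB/=; apply: eq_bigr => i _; rewrite mulrBr.
Qed.

Lemma is_integral_cst I c w : ok I -> cell_additive w ->
  is_integral I (fun=> c) w (c * w I).
Proof.
move=> oI aw; apply: cvg_near_cst; apply: near_division => P tP _.
by rewrite /riemann -mulr_sumr (additive_tiling aw oI tP).
Qed.

(** A cell with empty half-open part has divisions only into cells of this
    kind, whose weights are all zero. *)
Lemma is_integral_empty I F w : ok I -> cell_additive w -> (forall z, ~~ hop I z) ->
  is_integral I F w 0.
Proof.
move=> oI aw nI; apply: cvg_near_cst; apply: near_division => P tP _.
rewrite /riemann big1// => i _; have [okP _ _] := tP.
rewrite (additive_empty aw) ?mulr0// => z; apply: contra (nI z).
exact: hop_sub (tiling_sub tP).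
Qed.

(** A real bound on the sums rather than a supremum: only upper bounds on the
    variation are ever used, and this form is inherited by subcells at once. *)
Definition variation_bounded I w (V : R) := forall n (Q : 'I_n -> cell G), tiling I Q ->
  \sum_i `|w (Q i)| <= V.

Lemma variation_bounded_le I w (A B : R) :
  A <= B -> variation_bounded I w A -> variation_bounded I w B.
Proof. by move=> AB wA n Q tQ; exact: le_trans (wA n Q tQ) AB. Qed.

Lemma variation_bounded_family I w V (T : finType) (Q : T -> cell G) :
  variation_bounded I w V -> tiling I Q -> \sum_i `|w (Q i)| <= V.
Proof.
move=> h /tiling_enum /h; rewrite [X in _ -> X <= _](reindex _ (onW_bij _ (@enum_val_bij T))).
exact.
Qed.

(** A division of [I1] becomes a division of [I] by adding the cell [I2]. *)
Lemma variation_bounded_adjoin I1 I2 I w V : ok I2 -> adjoin I1 I2 I ->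
  variation_bounded I w V -> variation_bounded I1 w V.
Proof.
move=> ok2 aI vI n Q tQ.
have := variation_bounded_family vI (tiling_sum aI tQ (tiling_single ok2)).
rewrite big_sumType/=; apply: le_trans; rewrite lerDl; exact: sumr_ge0.
Qed.

Lemma is_integral_le I F w V M A : ok I -> 0 <= M ->
  (forall z, pts I z -> `|F z| <= M) -> variation_bounded I w V ->
  is_integral I F w A -> `|A| <= M * V.
Proof.
move=> oI M0 FM wV hA.
have := fine_divisions_proper oI => PF.
have hN : `|riemann F w P| @[P --> fine_divisions I] --> `|A| by exact: cvg_norm.
rewrite -(cvg_lim (@norm_hausdorff _ _) hN); apply: limr_le.
  by apply/cvg_ex; exists `|A|.
apply: near_division => P tP gP; rewrite /riemann.
apply: le_trans (ler_norm_sum _ _ _) _.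
apply: (@le_trans _ _ (\sum_i M * `|w (dcell P i)|)); last first.
  by rewrite -mulr_sumr ler_wpM2l// wV.
apply: ler_sum => i _; rewrite normrM ler_wpM2r// FM//.
by apply: (tiling_sub tP).
Qed.

(** Passing to a refinement does not change a Riemann sum when the values are
    kept, because the weight of a cell is the sum of the weights of its
    pieces. *)
Lemma refinement_weights (S T : finType) I (P : S -> cell G) (Q : T -> cell G)
    (f : S -> R) w : cell_additive w -> tiling I P -> tiling I Q ->
  \sum_i f i * w (P i) = \sum_ij f ij.1 * w (meet (P ij.1) (Q ij.2)).
Proof.
move=> aw tP tQ; have [okP _ _] := tP; have [okQ _ _] := tQ.
rewrite -(pair_bigA _ (fun i j => f i * w (meet (P i) (Q j))))/=.
apply: eq_bigr => i _; rewrite -mulr_sumr; congr (_ * _).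
apply/esym/aw => // [j|z]; first exact: ok_meet.
under eq_bigr do rewrite hop_meet.
case: (boolP (hop (P i) z)) => /= Piz; last by rewrite big1.
by rewrite (tiling_hop z tQ) (hop_sub (okP i) (tiling_sub tP) Piz).
Qed.

(** On the common refinement, a piece of nonzero weight has a point, which is
    in a cell of each of the two divisions; the two tags involved have values
    within [d + d] of one another. *)
Lemma riemann_close I F w V d P P' : cell_additive w -> variation_bounded I w V ->
  tiling I (dcell P) -> tiling I (dcell P') -> 0 <= d ->
  oscillation_lt F d P -> oscillation_lt F d P' ->
  `|riemann F w P - riemann F w P'| <= (d + d) * V.
Proof.
move=> aw wV tP tP' d0 oP oP'.
have tQ := tiling_meet tP tP'; have [okQ _ _] := tQ.
rewrite /riemann (refinement_weights _ aw tP tP') (refinement_weights _ aw tP' tP).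
rewrite [X in _ - X](reindex (fun ij => (ij.2, ij.1))) /=; last first.
  by exists (fun ij => (ij.2, ij.1)) => -[].
(* [meet] is symmetric up to the choice of degenerate placeholders. *)
have symw i j : w (meet (dcell P' j) (dcell P i)) = w (meet (dcell P i) (dcell P' j)).
  rewrite -[RHS](aw 'I_1 _ (fun=> meet (dcell P' j) (dcell P i))).
  - by rewrite big_ord1.
  - by move=> _; apply: ok_meet.
  - by apply: ok_meet.
  - by move=> z; rewrite big_ord1 !hop_meet andbC.
rewrite -sumrB; apply: le_trans (ler_norm_sum _ _ _) _.
apply: (@le_trans _ _ (\sum_ij (d + d) *
    `|w (meet (dcell P ij.1) (dcell P' ij.2))|)); last first.
  by rewrite -mulr_sumr ler_wpM2l ?addr_ge0// (variation_bounded_family wV tQ).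
apply: ler_sum => -[i j] _ /=; rewrite symw -mulrBl normrM.
case: (pselect (exists z, hop (meet (dcell P i) (dcell P' j)) z)) => [[z]|nz].
  rewrite hop_meet => /andP[/hop_pts iz /hop_pts jz]; rewrite ler_wpM2r//.
  rewrite (_ : _ - _ = (F z - F (dtag P' j)) - (F z - F (dtag P i))); last by ring.
  by apply: le_trans (ler_normB _ _) _; rewrite lerD// ltW// ?oP ?oP'.
rewrite (additive_empty aw) ?normr0 ?mulr0//; first exact: ok_meet.
by move=> z; apply/negP => hz; apply: nz; exists z.
Qed.

Lemma is_integral_exists I F w V : ok I -> cell_additive w -> variation_bounded I w V ->
  continuous F -> exists A, is_integral I F w A.
Proof.
move=> oI aw wV cF; apply/cvg_ex.
have := fine_divisions_proper oI => PF.
apply: cauchy_cvg; apply: cauchy_exP => e e0.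
(* Twice [d] times [V] must stay below [e]. *)
pose d := e / ((`|V| + 1) *+ 4).
have V0 : 0 < `|V| + 1 by rewrite ltr_wpDl.
have d0 : 0 < d by rewrite divr_gt0// pmulrn_lgt0.
have near_d : fine_divisions I
    [set P | tiling I (dcell P) /\ oscillation_lt F d P].
  by apply: filterI (near_oscillation I cF d0); exact: near_division.
have [P0 [tP0 oP0]] := filter_ex near_d.
exists (riemann F w P0); apply: filterS near_d => P [tP oP].
rewrite -ball_normE /=.
apply: le_lt_trans (riemann_close aw wV tP0 tP (ltW d0) oP0 oP) _.
apply: (@le_lt_trans _ _ ((d + d) * (`|V| + 1))).
  rewrite ler_wpM2l ?addr_ge0 ?(ltW d0)//.
  by rewrite (le_trans (ler_norm _))// lerDl.
rewrite (_ : _ * _ = e / 2); first by rewrite ltr_pdivrMr// ltr_pMr// ltr1n.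
by rewrite /d; field; rewrite gt_eqF.
Qed.

(** Fine divisions of two adjacent cells make up a fine division of their
    union; one gauge is taken finer than the gauges of the three integrals. *)
Lemma is_integral_adjoin I1 I2 I F w A1 A2 A :
  ok I1 -> ok I2 -> adjoin I1 I2 I ->
  is_integral I1 F w A1 -> is_integral I2 F w A2 -> is_integral I F w A ->
  A = A1 + A2.
Proof.
move=> ok1 ok2 aI h1 h2 h; apply/eqP; rewrite -subr_eq0 -normr_le0.
apply/ler_addgt0Pr => e e0; rewrite add0r.
have e3 : 0 < e / 3 by rewrite divr_gt0.
move/cvgrPdist_lt/(_ _ e3): h1 => -[g1 gg1 h1].
move/cvgrPdist_lt/(_ _ e3): h2 => -[g2 gg2 h2].
move/cvgrPdist_lt/(_ _ e3): h => -[g gg h].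
pose g' x := (g x `&` g1 x) `&` g2 x.
have gg' : gauge g'.
  move=> x; have [? ? fx] := gg x; have [? ? _] := gg1 x; have [? ? _] := gg2 x.
  split=> [|//|fxx y [[/fx + _] _]]; last exact.
  by apply: openI => //; exact: openI.
have [P1 [tP1 fP1]] := csn ok1 gg'; have [P2 [tP2 fP2]] := csn ok2 gg'.
pose Q (i : 'I_(dsize P1) + 'I_(dsize P2)) :=
  match i with inl i => dcell P1 i | inr i => dcell P2 i end.
pose t (i : 'I_(dsize P1) + 'I_(dsize P2)) :=
  match i with inl i => dtag P1 i | inr i => dtag P2 i end.
have tQ : tiling I Q by exact: tiling_sum aI tP1 tP2.
have fQ : fine_for g Q t.
  by move=> [i|i]; [have [? s] := fP1 i|have [? s] := fP2 i]; split=> // z /s[[]].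
have {}h1 := h1 _ tP1; have {}h2 := h2 _ tP2.
have {}h := h _ (tiling_tag_family t tQ) (fine_tag_family fQ).
have /h1 {}h1 : fine_for g1 (dcell P1) (dtag P1).
  by move=> i; have [? s] := fP1 i; split=> // z /s[[]].
have /h2 {}h2 : fine_for g2 (dcell P2) (dtag P2).
  by move=> i; have [? s] := fP2 i; split=> // z /s[[]].
move: h; rewrite {1}/riemann (sum_tag_family _ _ (fun x c => F x * w c)).
rewrite big_sumType/= -!/(riemann _ _ _) => h.
rewrite (_ : A - _ = (A - (riemann F w P1 + riemann F w P2)) -
  (A1 - riemann F w P1) - (A2 - riemann F w P2)); last by ring.
apply: le_trans (ler_normB _ _) _.
have -> : e = e / 3 + e / 3 + e / 3 by field.
rewrite lerD ?(ltW h2)//; apply: le_trans (ler_normB _ _) _.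
by rewrite lerD// ltW.
Qed.

End with_cousin.
End tilings.
Arguments dcell {G} _ _.
Arguments dtag {G} _ _.

(** * The extended line *)

Section line.
Variable R : realType.
Implicit Types (x y z p : \bar R) (J K I : itv1 R).

Lemma segmentE J x : segment J x = (J.1 <= x <= J.2)%E :> Prop.
Proof. by rewrite /segment /= in_itv. Qed.

Lemma ereal_between x y : (x < y)%E -> exists2 z : R, (x < z%:E)%E & (z%:E < y)%E.
Proof.
case: x y => [x||] [y||] //=.
- rewrite lte_fin => xy; exists ((x + y) / 2); rewrite lte_fin; lra.
- by move=> _; exists (x + 1); rewrite ?ltry// lte_fin ltrDl.
- by move=> _; exists (y - 1); rewrite ?ltNyr// lte_fin gtrBl.
- by move=> _; exists 0; rewrite ?ltry ?ltNyr.
Qed.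

Lemma nbhs_right_segment x (A : set (\bar R)) : nbhs x A -> (x < +oo)%E ->
  exists2 q, (x < q)%E & forall s, (x <= s <= q)%E -> A s.
Proof.
case: x => [x||] //=.
- move=> [e /= e0 xA] _; exists (x + e / 2)%:E; first by rewrite lte_fin ltrDl divr_gt0.
  case=> [s||] //=; rewrite ?lee_fin ?leye_eq ?leeNy_eq ?andbF //.
  move=> /andP[xs sx]; apply: xA; rewrite /= distrC ger0_norm ?subr_ge0//.
  by have : e / 2 < e; lra.
- move=> [M [_ MA]] _; exists (M - 1)%:E; first by rewrite ltNyr.
  by move=> s /andP[_ sM]; apply: MA; apply: le_lt_trans sM _; rewrite lte_fin gtrBl.
Qed.

Lemma nbhs_left_segment x (A : set (\bar R)) : nbhs x A -> (-oo < x)%E ->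
  exists2 q, (q < x)%E & forall s, (q <= s <= x)%E -> A s.
Proof.
case: x => [x||] //=.
- move=> [e /= e0 xA] _; exists (x - e / 2)%:E; first by rewrite lte_fin gtrBl divr_gt0.
  case=> [s||] //=; rewrite ?lee_fin ?leye_eq ?leeNy_eq ?andbF //.
  move=> /andP[xs sx]; apply: xA; rewrite /= ger0_norm ?subr_ge0//.
  by have : e / 2 < e; lra.
- move=> [M [_ MA]] _; exists (M + 1)%:E; first by rewrite ltry.
  by move=> s /andP[sM _]; apply: MA; apply: lt_le_trans sM; rewrite lte_fin ltrDl.
Qed.

Definition ok1 J : Prop := (J.1 <= J.2)%E.
Definition hop1 J x := (J.1 < x <= J.2)%E.
Definition meet1 J K : itv1 R :=
  let m := maxe J.1 K.1 in (m, maxe m (mine J.2 K.2)).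

Lemma open_range_fin1 : open (range (@fin1 R)).
Proof.
rewrite openE => _ [r _ <-]; rewrite /interior; exists 1 => //= s _.
by exists s.
Qed.

Lemma hop1_pts J z : hop1 J z -> segment J z.
Proof. by rewrite segmentE => /andP[/ltW -> ->]. Qed.

Lemma hop1_sub J I z : ok1 J -> segment J `<=` segment I -> hop1 J z -> hop1 I z.
Proof.
move=> oJ JI /andP[az zb].
have := JI J.1; have := JI J.2; rewrite !segmentE !lexx oJ /=.
move=> /(_ isT)/andP[_ bI] /(_ isT)/andP[aI _].
by rewrite /hop1 (le_lt_trans aI)//= (le_trans zb).
Qed.

(** The approaching point lies above every endpoint that is less than [z]. *)
Lemma hop1_approach (T : finType) (Q : T -> itv1 R) I z : hop1 I z ->
  exists2 w, segment I w & forall i, segment (Q i) w -> hop1 (Q i) z.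
Proof.
move=> /andP[az zb].
pose c i := if ((Q i).2 < z)%E then (Q i).2 else I.1.
pose m := \big[maxe/I.1]_i c i.
have mz : (m < z)%E.
  by rewrite /m; apply: bigmax_lt => // i _; rewrite /c; case: ifP.
have [w mw wz] := ereal_between mz.
exists w%:E.
  rewrite segmentE (le_trans (ltW wz) zb) andbT.
  exact: le_trans (bigmax_ge_id _ _ _ _) (ltW mw).
move=> i; rewrite segmentE => /andP[wi iw]; rewrite /hop1 (le_lt_trans wi)//=.
rewrite leNgt; apply/negP => iz.
have : (c i <= m)%E by exact: le_bigmax.
by rewrite /c iz leNgt (lt_le_trans mw).
Qed.

Lemma measurable_fin1_segment J : measurable (@fin1 R @^-1` segment J).
Proof.
rewrite -[_ @^-1` _]setTI; apply: (@EFin_measurable _ setT) => //.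
exact: emeasurable_itv.
Qed.

(** Two intervals overlap in more than one point exactly when they share a
    nondegenerate interval, and then they share the upper end of it, which is
    in both half-open parts. *)
Lemma null1P J K :
  null1 (segment J `&` segment K) <-> forall z, ~~ (hop1 J z && hop1 K z).
Proof.
have mJK : measurable (@fin1 R @^-1` (segment J `&` segment K)).
  by rewrite preimage_setI; apply: measurableI; exact: measurable_fin1_segment.
split=> [|no].
  rewrite /null1 => n0 z; apply/negP => /andP[/andP[Jz zJ] /andP[Kz zK]].
  have mz : (maxe J.1 K.1 < z)%E by rewrite gt_max Jz.
  have [u mu uz] := ereal_between mz; have [v uv vz] := ereal_between uz.
  have : (@lebesgue_measure R `[u, v] <=
      lebesgue_measure (@fin1 R @^-1` (segment J `&` segment K)))%E.
    apply: le_measure; rewrite ?inE//= => t; rewrite /= in_itv/= => /andP[ut tv].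
    have mt : (maxe J.1 K.1 <= t%:E)%E by rewrite (le_trans (ltW mu))// lee_fin.
    have tz : (t%:E <= z)%E by rewrite (le_trans _ (ltW vz))// lee_fin.
    move: mt; rewrite ge_max => /andP[Jt Kt].
    by rewrite !segmentE Jt Kt (le_trans tz) ?(le_trans tz zK).
  rewrite n0 lebesgue_measure_itv/= lte_fin -lte_fin uv -EFinB lee_fin.
  by rewrite leNgt subr_gt0 -lte_fin uv.
have [m mP] : exists m, segment J `&` segment K `<=` [set m].
  exists (maxe J.1 K.1) => t [] /=; rewrite !segmentE => /andP[Jt tJ] /andP[Kt tK].
  apply/eqP; rewrite eq_le ge_max Jt Kt !andbT leNgt; apply/negP.
  rewrite gt_max => /andP[J1 K1]; have := no t.
  by rewrite /hop1 J1 K1 tJ tK.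
apply/eqP; rewrite eq_le measure_ge0 andbT.
have -> : 0%E = lebesgue_measure [set fine m] by rewrite lebesgue_measure_set1.
apply: le_measure; rewrite ?inE// => t /mP /= <-.
by [].
Qed.

Lemma ok_meet1 J K : ok1 (meet1 J K).
Proof. by rewrite /ok1 /= le_max lexx. Qed.

Lemma hop1_meet J K z : hop1 (meet1 J K) z = hop1 J z && hop1 K z.
Proof.
rewrite /hop1/= gt_max !le_max le_min.
case: (ltP J.1 z) => //= Jz; case: (ltP K.1 z) => Kz //=; last by rewrite andbF.
Qed.

Lemma segment_meet J K : segment J `&` segment K `<=` segment (meet1 J K).
Proof.
move=> t []; rewrite !segmentE => /andP[Jt tJ] /andP[Kt tK].
by rewrite /= ge_max Jt Kt le_max le_min tJ tK orbT.
Qed.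

Lemma meet1_sub J K I : ok1 J -> ok1 K -> segment J `<=` segment I ->
  segment K `<=` segment I -> segment (meet1 J K) `<=` segment I.
Proof.
move=> oJ oK JI KI t; have := JI J.1; have := JI J.2; have := KI K.1.
have := KI K.2; rewrite !segmentE !lexx oJ oK /=.
move=> /(_ isT)/andP[_ K2] /(_ isT)/andP[K1 K1'] /(_ isT)/andP[_ J2].
move=> /(_ isT)/andP[J1 J1'] /andP[]; rewrite ge_max le_max le_min => /andP[Jt Kt].
rewrite (le_trans J1 Jt)/= le_max => /orP[/orP[]|/andP[tJ _]].
- by move/le_trans; exact.
- by move/le_trans; exact.
- exact: le_trans J2.
Qed.

Definition line : geometry := @Geometry (\bar R) (range (@fin1 R)) (itv1 R) ok1
  (@segment R) (@null1 R) hop1 meet1 open_range_fin1 hop1_pts hop1_sub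
  hop1_approach null1P ok_meet1 hop1_meet segment_meet meet1_sub.

End line.

(** * Cousin's lemma on the line *)

Section line_theory.
Variable R : realType.
Implicit Types (x y z p : \bar R) (J K I : itv1 R).

Lemma adjoin_line x y z : (x <= y)%E -> (y <= z)%E ->
  @adjoin (line R) (x, y) (y, z) (x, z).
Proof.
move=> xy yz; split=> [|t].
  apply/seteqP; split=> t; rewrite /= !segmentE /=.
    by move=> [|] /andP[? ?]; apply/andP; split => //; exact: le_trans yz || exact: le_trans xy _.
  move=> /andP[xt tz]; case: (leP t y) => ty; [left|right].
    by rewrite xt.
  by rewrite (ltW ty).
by rewrite /= /hop1 /=; case: (ltP y t) => /= yt; rewrite ?andbF// andbT leNgt yt andbF.
Qed.

(** Let [c] be the supremum of the [z] for which [a, z] has a fine division.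
    The neighbourhood of [c] contains an interval [y, c] with [y] such a [z],
    so [c] is one as well, and if [c < b] it contains an interval beyond [c],
    which contradicts the choice of [c]. *)
Lemma has_fine_line (gam : \bar R -> set (\bar R)) I :
  (forall x, nbhs x (gam x)) -> ok1 I -> @has_fine (line R) gam I.
Proof.
case: I => a b ngam /= ab; rewrite /ok1 /= in ab.
have single x y z : (x <= y)%E -> (x <= z <= y)%E ->
    (forall s, (x <= s <= y)%E -> gam z s) -> @has_fine (line R) gam (x, y).
  move=> xy zxy h; exact: (@has_fine_single (line R) gam (x, y) z).
pose S := [set z | (a <= z <= b)%E /\ @has_fine (line R) gam (a, z)].
have Sa : S a.
  split; first by rewrite lexx.
  apply: (single _ _ a); rewrite ?lexx// => s /andP[a1 a2].
  by rewrite (@le_anti _ _ s a) ?a1 ?a2//; exact: nbhs_singleton.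
pose c := ereal_sup S.
have ac : (a <= c)%E by exact: ereal_sup_ubound.
have cb : (c <= b)%E by apply: ge_ereal_sup => z [/andP[]].
have extend x y : S x -> (x <= y <= b)%E -> @has_fine (line R) gam (x, y) -> S y.
  move=> [/andP[ax xb] fx] /andP[xy yb] fxy; split; first by rewrite (le_trans ax)/=.
  exact: (@has_fine_adjoin (line R) gam (a, x) (x, y)) (adjoin_line ax xy) fx fxy.
have Sc : S c.
  have [<-//|ltac] := eqVneq a c.
  have {}ltac : (a < c)%E by rewrite lt_neqAle ltac.
  have [q qc qP] := nbhs_left_segment (ngam c) (le_lt_trans (leNye _) ltac).
  have /ereal_sup_gt[y Sy] : (maxe a q < c)%E by rewrite gt_max ltac.
  rewrite gt_max => /andP[ay qy].
  have yc : (y <= c)%E by exact: ereal_sup_ubound.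
  apply: (extend y) => //; first by rewrite yc.
  apply: (single _ _ c); rewrite ?yc ?lexx// => s /andP[ys sc].
  by apply: qP; rewrite sc (le_trans (ltW qy)).
have [<-|cneb] := eqVneq c b; first by case: Sc.
have ltcb : (c < b)%E by rewrite lt_neqAle cneb.
have [q cq qP] := nbhs_right_segment (ngam c) (lt_le_trans ltcb (leey _)).
have cz : (c < mine q b)%E by rewrite lt_min cq.
have : S (mine q b).
  apply: (extend c) => //; first by rewrite (ltW cz) ge_min lexx orbT.
  apply: (single _ _ c); rewrite ?lexx ?(ltW cz)// => s /andP[cs sm].
  by apply: qP; rewrite cs (le_trans sm)// ge_min lexx.
by move/ereal_sup_ubound; rewrite -/c leNgt cz.
Qed.

Lemma cousin_line : cousin (line R).
Proof.
move=> I oI gam gg; apply: has_fine_line => // x.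
by have [? ? _] := gg x; exact: open_nbhs_nbhs.
Qed.

(** Cousin's lemma extracts a finite covering from the neighbourhoods given
    at each point. *)
Lemma ereal_segment_compact I : compact (segment I).
Proof.
case: (boolP (I.1 <= I.2)%E) => [oI|nI]; last first.
  rewrite (_ : segment I = set0); first exact: compact0.
  apply/seteqP; split=> // t; rewrite segmentE => /andP[It tI].
  by move/negP: nI; apply; exact: le_trans tI.
apply/compact_near_coveringP => T F P FF cov.
have /choice[A AP] : forall x, exists AB : set (\bar R) * set T,
    [/\ nbhs x AB.1, F AB.2 & segment I x ->
        forall y i, AB.1 y -> AB.2 i -> P i y].
  move=> x; case: (pselect (segment I x)) => Ix; last first.
    by exists (setT, setT); split=> //=; exact: filterT.
  by have [AB [? ?] h] := cov _ Ix; exists AB; split=> // _ y i ? ?; apply: (h (y, i)).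
have nA x : nbhs x (A x).1 by have [] := AP x.
have [D [tD fD]] := has_fine_line nA oI.
have : \forall i \near F, forall j, (A (dtag D j)).2 i.
  by apply: filter_forall => j; have [] := AP (dtag D j).
apply: filterS => i iD x; rewrite -[segment I]/(@pts (line R) I).
have [_ <- _] := tD => -[j _ jx]; have [Dj Dg] := fD j.
have [_ _] := AP (dtag D j); apply=> //; last exact: Dg.
by apply: (tiling_sub tD) Dj.
Qed.

(** * Increments are additive over divisions *)

(** The points [q] list [s] in increasing order; an interval with endpoints in
    [s] is made of the consecutive steps (q k, q k.+1] that end in its
    half-open part, and the increment telescopes over them.  The grid serves
    all functions [h] and all such intervals simultaneously. *)
Lemma incr1_grid (s : seq (\bar R)) : exists n (q : nat -> \bar R),
  forall J, J.1 \in s -> J.2 \in s -> ok1 J -> forall h : \bar R -> R,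
  incr1 h J = \sum_(k < n) (hop1 J (q k.+1))%:R * (h (q k.+1) - h (q k)).
Proof.
pose s' := sort <=%O (undup s).
have ss' : sorted <%O s' by rewrite sort_lt_sorted undup_uniq.
have ins x : x \in s -> exists2 i, (i < size s')%N & x = nth -oo%E s' i.
  move=> xs; exists (index x s'); last by rewrite nth_index// mem_sort mem_undup.
  by rewrite index_mem mem_sort mem_undup.
exists (size s').-1, (nth -oo%E s') => -[_ _] /= /ins[i si ->] /ins[j sj ->] ij h.
rewrite /ok1 /= in ij.
have {}ij : (i <= j)%N by rewrite leqNgt -(lt_sorted_ltn_nth -oo%E ss')// -leNgt.
rewrite /incr1 /= -(telescope_sumr (fun k => h (nth -oo%E s' k)))//.
rewrite (big_nat_widen _ _ (size s').-1); last by case: (size s') sj.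
rewrite (big_nat_widenl i 0)// big_mkord big_mkcond /=.
apply: eq_bigr => k _; rewrite -mulrb mulr_natl; congr (_ *+ nat_of_bool _).
have kS : (k.+1 < size s')%N by rewrite -ltn_predRL.
rewrite /hop1 /= (lt_sorted_ltn_nth -oo%E ss')// ltnS andbC leNgt.
by rewrite (lt_sorted_ltn_nth -oo%E ss')// -leqNgt.
Qed.

Definition endpoints (T : finType) (Q : T -> itv1 R) I : seq (\bar R) :=
  [:: I.1; I.2] ++ [seq (Q i).1 | i <- enum T] ++ [seq (Q i).2 | i <- enum T].

Lemma mem_endpoints (T : finType) (Q : T -> itv1 R) I :
  [/\ I.1 \in endpoints Q I, I.2 \in endpoints Q I,
      forall i, (Q i).1 \in endpoints Q I & forall i, (Q i).2 \in endpoints Q I].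
Proof.
split=> [| |i|i]; rewrite !mem_cat !inE ?eqxx ?orbT//.
  by rewrite (map_f (fun i => (Q i).1)) ?mem_enum ?orbT.
by rewrite (map_f (fun i => (Q i).2)) ?mem_enum ?orbT.
Qed.

(** Over a grid containing all endpoints, both sides are combinations of the
    same elementary increments, whose coefficients agree since half-open parts
    are partitioned. *)
Lemma incr1_additive (h : \bar R -> R) : @cell_additive R (line R) (incr1 h).
Proof.
move=> T I Q okQ oI cnt; have [I1 I2 Q1 Q2] := mem_endpoints Q I.
have [n [q qP]] := incr1_grid (endpoints Q I).
rewrite (qP I)// (eq_bigr _ (fun i _ => qP _ (Q1 i) (Q2 i) (okQ i) h)).
rewrite exchange_big/=; apply: eq_bigr => k _; rewrite -mulr_suml; congr (_ * _).
by rewrite -natr_sum; congr (_%:R); exact: cnt.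
Qed.

End line_theory.

(** * The extended plane *)

Section plane.
Variable R : realType.
Implicit Types (J K : itv1 R) (Q I : itv2 R) (z : \bar R * \bar R).

Definition ok2 Q : Prop := ok1 Q.1 /\ ok1 Q.2.
Definition hop2 Q z := hop1 Q.1 z.1 && hop1 Q.2 z.2.
Definition meet2 Q Q' : itv2 R := (meet1 Q.1 Q'.1, meet1 Q.2 Q'.2).

Lemma range_fin2 : range (@fin2 R) = range (@fin1 R) `*` range (@fin1 R).
Proof.
apply/seteqP; split=> [_ [[x y] _ <-]|[_ _] [/= [x _ <-] [y _ <-]]].
  by split; [exists x|exists y].
by exists (x, y).
Qed.

Lemma open_range_fin2 : open (range (@fin2 R)).
Proof.
rewrite openE => _ [r _ <-]; exists (range (@fin1 R), range (@fin1 R)).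
  by split; apply: open_nbhs_nbhs; split; [exact: open_range_fin1|eexists|
    exact: open_range_fin1|eexists].
by rewrite range_fin2 => z [].
Qed.

Lemma hop2_pts Q z : hop2 Q z -> box Q z.
Proof. by move=> /andP[h1 h2]; split; exact: hop1_pts. Qed.

Lemma segment_bounds J : ok1 J -> segment J J.1 /\ segment J J.2.
Proof. by move=> oJ; rewrite !segmentE !lexx andbT. Qed.

Lemma box_sub Q I : ok2 Q -> box Q `<=` box I ->
  segment Q.1 `<=` segment I.1 /\ segment Q.2 `<=` segment I.2.
Proof.
move=> [/segment_bounds[Q1 _] /segment_bounds[Q2 _]] QI; split=> t Qt.
  by have [] := QI (t, Q.2.1) (conj Qt Q2).
by have [] := QI (Q.1.1, t) (conj Q1 Qt).
Qed.

Lemma hop2_sub Q I z : ok2 Q -> box Q `<=` box I -> hop2 Q z -> hop2 I z.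
Proof.
move=> oQ /(box_sub oQ)[s1 s2] /andP[h1 h2]; case: oQ => o1' o2'.
by apply/andP; split; [exact: hop1_sub h1|exact: hop1_sub h2].
Qed.

Lemma hop2_approach (T : finType) (Q : T -> itv2 R) I z : hop2 I z ->
  exists2 w, box I w & forall i, box (Q i) w -> hop2 (Q i) z.
Proof.
move=> /andP[h1 h2].
have [w1 I1 w1P] := hop1_approach (fun i => (Q i).1) h1.
have [w2 I2 w2P] := hop1_approach (fun i => (Q i).2) h2.
by exists (w1, w2) => // i [/= /w1P q1 /w2P q2]; apply/andP.
Qed.

(** The overlap of two rectangles is a product, so it is null exactly when one
    of its factors is. *)
Lemma null2P Q Q' :
  null2 (box Q `&` box Q') <-> forall z, ~~ (hop2 Q z && hop2 Q' z).
Proof.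
have mX (J K : itv1 R) : measurable (@fin1 R @^-1` (segment J `&` segment K)).
  by rewrite preimage_setI; apply: measurableI; exact: measurable_fin1_segment.
have -> : null2 (box Q `&` box Q') <->
    null1 (segment Q.1 `&` segment Q'.1) \/ null1 (segment Q.2 `&` segment Q'.2).
  rewrite /null2 (_ : _ @^-1` _ = (@fin1 R @^-1` (segment Q.1 `&` segment Q'.1))
      `*` (@fin1 R @^-1` (segment Q.2 `&` segment Q'.2))); last first.
    apply/seteqP; split=> [[x y] [[/= ? ?] [/= ? ?]]|[x y] [[/= ? ?] [/= ? ?]]];
    by split; split.
  rewrite product_measure1E; [|exact: mX|exact: mX].
  split=> [/eqP|].
    by rewrite mule_eq0 => /orP[] /eqP ?; [left|right].
  by case=> h; apply/eqP; rewrite mule_eq0; apply/orP; [left|right]; apply/eqP.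
rewrite !null1P; split=> [[] h z|no].
- apply: contra (h z.1); rewrite /hop2.
  by move=> /andP[/andP[-> _] /andP[-> _]].
- apply: contra (h z.2); rewrite /hop2.
  by move=> /andP[/andP[_ ->] /andP[_ ->]].
apply: contrapT => /not_orP[/existsNP[x /negP + ] /existsNP[y /negP + ]].
rewrite !negbK => /andP[x1 x2] /andP[y1 y2].
by have := no (x, y); rewrite /hop2 x1 x2 y1 y2.
Qed.

Lemma ok_meet2 Q Q' : ok2 (meet2 Q Q').
Proof. by split; exact: ok_meet1. Qed.

Lemma hop2_meet Q Q' z : hop2 (meet2 Q Q') z = hop2 Q z && hop2 Q' z.
Proof. by rewrite /hop2 !hop1_meet andbACA. Qed.

Lemma box_meet Q Q' : box Q `&` box Q' `<=` box (meet2 Q Q').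
Proof. by move=> z [[? ?] [? ?]]; split; apply: segment_meet. Qed.

Lemma meet2_sub Q Q' I : ok2 Q -> ok2 Q' -> box Q `<=` box I ->
  box Q' `<=` box I -> box (meet2 Q Q') `<=` box I.
Proof.
move=> oQ oQ' /(box_sub oQ)[s1 s2] /(box_sub oQ')[s1' s2'] z [m1 m2].
case: oQ oQ' => ? ? [? ?].
by split; [move: m1|move: m2]; apply: meet1_sub.
Qed.

Definition plane : geometry := @Geometry (\bar R * \bar R)%type
  (range (@fin2 R)) (itv2 R) ok2 (@box R) (@null2 R) hop2 meet2 open_range_fin2
  hop2_pts hop2_sub hop2_approach null2P ok_meet2 hop2_meet box_meet meet2_sub.

Lemma incr2E (g : \bar R * \bar R -> R) Q :
  incr2 g Q = incr1 (fun y => incr1 (fun x => g (x, y)) Q.1) Q.2.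
Proof. by case: Q => -[a b] [c d]; rewrite /incr2 /incr1 /=; ring. Qed.

Lemma incr2E' (g : \bar R * \bar R -> R) Q :
  incr2 g Q = incr1 (fun x => incr1 (fun y => g (x, y)) Q.2) Q.1.
Proof. by case: Q => -[a b] [c d]; rewrite /incr2 /incr1 /=; ring. Qed.

(** As on the line, with the product of a grid in each variable. *)
Lemma incr2_additive (g : \bar R * \bar R -> R) : @cell_additive R plane (incr2 g).
Proof.
move=> T I Q okQ oI cnt.
have [I11 I12 Q11 Q12] := mem_endpoints (fun i => (Q i).1) I.1.
have [I21 I22 Q21 Q22] := mem_endpoints (fun i => (Q i).2) I.2.
have [n [q qP]] := incr1_grid (endpoints (fun i => (Q i).1) I.1).
have [m [r rP]] := incr1_grid (endpoints (fun i => (Q i).2) I.2).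
pose cel k l := incr2 g ((q k, q k.+1), (r l, r l.+1)).
have gridE (C : itv2 R) : (C.1.1 \in endpoints (fun i => (Q i).1) I.1) ->
    C.1.2 \in endpoints (fun i => (Q i).1) I.1 ->
    C.2.1 \in endpoints (fun i => (Q i).2) I.2 ->
    C.2.2 \in endpoints (fun i => (Q i).2) I.2 -> ok2 C ->
    incr2 g C = \sum_(kl : 'I_n * 'I_m)
      (hop2 C (q kl.1.+1, r kl.2.+1))%:R * cel kl.1 kl.2.
  move=> C11 C12 C21 C22 [ok1C ok2C].
  rewrite incr2E rP// -(pair_bigA _ (fun (k : 'I_n) (l : 'I_m) => (hop2 C (q k.+1, r l.+1))%:R * cel k l))/=.
  rewrite exchange_big; apply: eq_bigr => l _.
  rewrite !qP// -sumrB mulr_sumr; apply: eq_bigr => k _.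
  rewrite /hop2 -mulnb natrM -mulrBr mulrCA mulrA; congr (_ * _).
  by rewrite /cel /incr2; ring.
rewrite (gridE I)// (eq_bigr _ (fun i _ =>
  gridE (Q i) (Q11 i) (Q12 i) (Q21 i) (Q22 i) (okQ i))).
rewrite exchange_big/=; apply: eq_bigr => kl _; rewrite -mulr_suml; congr (_ * _).
by rewrite -natr_sum; congr (_%:R); exact: cnt.
Qed.

Lemma adjoin_plane1 (J1 J2 J K : itv1 R) : @adjoin (line R) J1 J2 J ->
  @adjoin plane (J1, K) (J2, K) (J, K).
Proof.
move=> [cJ dJ]; split=> [|z].
  apply/seteqP; rewrite /= /box /=; move: cJ; rewrite /= => <-; split=> z.
    by move=> [[? ?]|[? ?]]; split=> //; [left|right].
  by move=> [[?|?] ?]; [left|right].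
apply: contra (dJ z.1).
by rewrite /= /hop2 => /andP[/andP[-> _] /andP[-> _]].
Qed.

Lemma adjoin_plane2 (J1 J2 J K : itv1 R) : @adjoin (line R) J1 J2 J ->
  @adjoin plane (K, J1) (K, J2) (K, J).
Proof.
move=> [cJ dJ]; split=> [|z].
  apply/seteqP; rewrite /= /box /=; move: cJ; rewrite /= => <-; split=> z.
    by move=> [[? ?]|[? ?]]; split=> //; [left|right].
  by move=> [? [?|?]]; [left|right].
apply: contra (dJ z.2).
by rewrite /= /hop2 => /andP[/andP[_ ->] /andP[_ ->]].
Qed.

(** * Slicing a rectangle into strips *)

(** The division of the first factor may depend on the strip. *)
Lemma tiling_strips (T : finType) (S : T -> finType) (K J : itv1 R)
    (D : forall i, S i -> itv1 R) (L : T -> itv1 R) :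
  (forall i, @tiling (line R) (S i) K (@D i)) -> @tiling (line R) T J L ->
  @tiling plane {i : T & S i} (K, J)
    (fun p => (@D (tag p) (tagged p), L (tag p))).
Proof.
move=> tD tL; have [okL cL thL] := tL; split=> [[i j]| |[i j] [k l] ne].
- by split; [have [okD _ _] := tD i; exact: okD|exact: okL].
- apply/seteqP; split=> [[x y] [[i j] _ [/= Dx Ly]]|[x y] [/= Kx Jy]].
    by split; [exact: tiling_sub (tD i) _ Dx|exact: tiling_sub tL _ Ly].
  move: Jy; rewrite -[segment J]/(@pts (line R) J) -cL => -[i _ Ly].
  move: Kx; rewrite -[segment K]/(@pts (line R) K); have [_ <- _] := tD i.
  by move=> [j _ Dx]; exists (Tagged (fun i => S i) j).
- apply/null2P => -[x y]; apply/negP.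
  move=> /andP[/andP[/= Dx Ly] /andP[/= Dx' Ly']].
  have ik : i = k.
    apply/eqP; apply/negPn/negP => /thL /(@thinP (line R))/(_ y) /=.
    by rewrite Ly Ly'.
  move: l ne Dx' Ly'; rewrite -{k}ik => l ne Dx' _.
  have [_ _ th] := tD i.
  have /th /(@thinP (line R))/(_ x) /= : j != l by apply: contra ne => /eqP ->.
  by rewrite Dx Dx'.
Qed.

(** For each [t], Cousin's lemma in the first variable gives a tagged division
    [D t] of [K] that is fine for the gauge at height [t].  The cells of [D t]
    are compact, hence they stay inside the open sets of the gauge at all
    heights close to [t]; these heights form the gauge [g1]. *)
Lemma strip_gauge (gam : \bar R * \bar R -> set (\bar R * \bar R)) K :
  @gauge plane gam -> ok1 K ->
  exists2 g1, @gauge (line R) g1 & exists D : \bar R -> tagged_division (line R),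
    forall t, @tiling (line R) _ K (dcell (D t)) /\ forall J, segment J `<=` g1 t ->
      segment J t -> forall j,
        @box R (dcell (D t) j, J) (dtag (D t) j, t) /\
        @box R (dcell (D t) j, J) `<=` gam (dtag (D t) j, t).
Proof.
move=> gg oK.
have [g0 gg0 _] := @filterT _ _ (fine_divisions_filter (whole1 R : cell (line R))).
have ex t : exists D : tagged_division (line R), @tiling (line R) _ K (dcell D) /\
    @fine_for (line R) (fun s => [set s' | gam (s, t) (s', t)]) _ (dcell D) (dtag D).
  apply: has_fine_line => // s; have [opg gst _] := gg (s, t).
  have : nbhs (s, t) (gam (s, t)) by exact: open_nbhs_nbhs.
  move=> [[A B] /= [nA nB] AB]; apply: filterS nA => s' As'.
  by apply: AB; split=> //=; exact: nbhs_singleton.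
have [D DP] := choice ex.
pose N t := [set t' | forall j, segment (dcell (D t) j) `<=`
  [set s | gam (dtag (D t) j, t) (s, t')]].
have nN t : nbhs t (N t).
  apply: filter_forall => j.
  have /compact_near_coveringP := @ereal_segment_compact R (dcell (D t) j).
  apply=> s Ds; have [_ /(_ j)[_ /(_ _ Ds) gs]] := DP t.
  have [opg _ _] := gg (dtag (D t) j, t).
  have [AB nAB ABg] := open_nbhs_nbhs (conj opg gs).
  by exists AB => // -[s' t'] /ABg.
exists (fun t => interior (N t) `&` g0 t).
  move=> t; have [opg0 g0t f0] := gg0 t; split.
  - by apply: openI => //; exact: open_interior.
  - by split=> //; exact: nN.
  - by move=> ft x [_ gx]; exact: f0.
exists D => t; have [tD fD] := DP t; split=> // J Jt Jtt j.
have [Dj _] := fD j; split; first by split.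
by move=> [s t'] [/= Ds /Jt[/interior_subset/(_ j) h _]]; exact: h.
Qed.

Lemma strip_fine (gam : \bar R * \bar R -> set (\bar R * \bar R))
    (g1 : \bar R -> set (\bar R)) (D : \bar R -> tagged_division (line R)) K J (P : tagged_division (line R)) :
  (forall t, @tiling (line R) _ K (dcell (D t)) /\ forall J, segment J `<=` g1 t ->
      segment J t -> forall j,
        @box R (dcell (D t) j, J) (dtag (D t) j, t) /\
        @box R (dcell (D t) j, J) `<=` gam (dtag (D t) j, t)) ->
  @tiling (line R) _ J (dcell P) -> @fine_for (line R) g1 _ (dcell P) (dtag P) ->
  let Q (p : {i : 'I_(dsize P) & 'I_(dsize (D (dtag P i)))}) : cell plane :=
    (dcell (D (dtag P (tag p))) (tagged p), dcell P (tag p)) in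
  let t (p : {i : 'I_(dsize P) & 'I_(dsize (D (dtag P i)))}) : gpoint plane :=
    (dtag (D (dtag P (tag p))) (tagged p), dtag P (tag p)) in
  @tiling plane _ (K, J) Q /\ @fine_for plane gam _ Q t.
Proof.
move=> DP tP fP Q t; split.
  apply: (@tiling_strips _ (fun i => 'I_(dsize (D (dtag P i))))
    K J (fun i => dcell (D (dtag P i)))) => // i.
  by have [] := DP (dtag P i).
move=> [i j]; have [Pi gi] := fP i; have [_ h] := DP (dtag P i).
exact: h.
Qed.

Lemma cousin_plane : cousin plane.
Proof.
move=> [K J] [/= oK oJ] gam gg.
have [g1 gg1 [D DP]] := strip_gauge gg oK.
have [P [tP fP]] := cousin_line oJ gg1.
have [tQ fQ] := strip_fine DP tP fP.
exact: has_fine_family tQ fQ.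
Qed.

(** Over the strips above a fine division of [J], the Riemann sum of [v z.2]
    collapses to a sum over [J], since the tags above one interval share their
    height and the increments over one strip add up. *)
Lemma is_integral_snd K J (v : \bar R -> R) (g : \bar R * \bar R -> R) A B :
  ok1 K -> ok1 J -> @is_integral R plane (K, J) (fun z => v z.2) (incr2 g) A ->
  @is_integral R (line R) J v (fun L => incr2 g (K, L)) B -> A = B.
Proof.
move=> oK oJ hA hB; apply/eqP; rewrite -subr_eq0 -normr_le0.
apply/ler_addgt0Pr => e e0; rewrite add0r.
have e2 : 0 < e / 2 by rewrite divr_gt0.
move/cvgrPdist_lt/(_ _ e2): hA => -[g2 gg2 hA].
move/cvgrPdist_lt/(_ _ e2): hB => -[g1' gg1' hB].
have [g1 gg1 [D DP]] := strip_gauge gg2 oK.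
have gg : @gauge (line R) (fun x => g1 x `&` g1' x).
  move=> x; have [? ? fx] := gg1 x; have [? ? _] := gg1' x.
  by split=> [|//|ffx y [/(fx ffx)]//]; exact: openI.
have [P [tP fP]] := cousin_line oJ gg.
have fP1 : @fine_for (line R) g1 _ (dcell P) (dtag P).
  by move=> i; have [? s] := fP i; split=> // z /s[].
have /(hB _ tP) {}hB : @fine_for (line R) g1' _ (dcell P) (dtag P).
  by move=> i; have [? s] := fP i; split=> // z /s[].
have [tQ fQ] := strip_fine DP tP fP1.
have := hA _ (tiling_tag_family _ tQ) (fine_tag_family fQ).
rewrite {1}/riemann (sum_tag_family _ _ (fun (x : gpoint plane) (c : cell plane) => v x.2 * incr2 g c)).
have <- : @riemann R (line R) v (fun L => incr2 g (K, L)) P =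
    \sum_(p : {i : 'I_(dsize P) & 'I_(dsize (D (dtag P i)))})
      v (dtag P (tag p)) *
      incr2 g (dcell (D (dtag P (tag p))) (tagged p), dcell P (tag p)).
  transitivity (\sum_i \sum_(j < dsize (D (dtag P i)))
      v (dtag P i) * incr2 g (dcell (D (dtag P i)) j, dcell P i)).
    apply: eq_bigr => i _; rewrite -mulr_sumr; congr (_ * _).
    rewrite [LHS]incr2E' (eq_bigr _ (fun j _ => incr2E' _ _)).
    exact/esym/(additive_tiling (incr1_additive _) oK (DP (dtag P i)).1).
  exact: (sig_big_dep _ (fun=> xpredT) (fun i (j : 'I_(dsize (D (dtag P i)))) =>
    v (dtag P i) * incr2 g (dcell (D (dtag P i)) j, dcell P i))).
move=> {}hA; have -> : A - B = (A - @riemann R (line R) v (fun L => incr2 g (K, L)) P) -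
  (B - @riemann R (line R) v (fun L => incr2 g (K, L)) P) by ring.
have -> : e = e / 2 + e / 2 by field.
by apply: le_trans (ler_normB _ _) _; rewrite lerD// ltW.
Qed.

(** * Variation over parts of the line and of the plane *)

Lemma variation_bounded_line (w : itv1 R -> R) (V : R) (I : itv1 R) : ok1 I ->
  @variation_bounded R (line R) (whole1 R) w V -> @variation_bounded R (line R) I w V.
Proof.
case: I => a b oI vW.
have vb : @variation_bounded R (line R) (-oo%E, b) w V.
  apply: (variation_bounded_adjoin _ (adjoin_line (leNye _) (leey _))) vW.
  exact: leey.
apply: (variation_bounded_adjoin _ (adjoin_sym (adjoin_line (leNye a) oI))) vb.
exact: leNye.
Qed.

Lemma variation_bounded_plane (w : itv2 R -> R) (V : R) I : ok2 I ->
  @variation_bounded R plane (whole2 R) w V -> @variation_bounded R plane I w V.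
Proof.
case: I => [[a b] [c d]] [oI oJ] vW.
have vb : @variation_bounded R plane ((-oo%E, b), whole1 R) w V.
  apply: (variation_bounded_adjoin _ (adjoin_plane1 (whole1 R) (adjoin_line (leNye _) (leey _)))) vW.
  by split; [exact: leey|exact: leey].
have {}vb : @variation_bounded R plane ((a, b), whole1 R) w V.
  apply: (variation_bounded_adjoin _ (adjoin_plane1 (whole1 R) (adjoin_sym (adjoin_line (leNye a) oI)))) vb.
  by split; [exact: leNye|exact: leey].
have {}vb : @variation_bounded R plane ((a, b), (-oo%E, d)) w V.
  apply: (variation_bounded_adjoin _ (adjoin_plane2 (a, b) (adjoin_line (leNye _) (leey _)))) vb.
  by split; [exact: oI|exact: leey].
apply: (variation_bounded_adjoin _ (adjoin_plane2 (a, b) (adjoin_sym (adjoin_line (leNye c) oJ)))) vb.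
by split; [exact: oI|exact: leNye].
Qed.

End plane.

(** * Stieltjes integrals as limits along fine divisions *)

Section phi.
Variable R : realType.
Implicit Types (F g : \bar R * \bar R -> R) (h v : \bar R -> R).
Implicit Types (I J K : itv1 R) (Q : itv2 R).

Lemma is_HS1E I v h A :
  is_HS1 I v h A <-> @is_integral R (line R) I v (incr1 h) A.
Proof.
split=> [H|/cvgrPdist_lt H e e0].
  apply/cvgrPdist_lt => e e0; have [gam gg gP] := H e e0.
  by exists gam => // P tP fP; rewrite distrC; exact: gP.
have [gam gg gP] := H e e0; exists gam => // n J t dJ fJ.
rewrite distrC; exact: (gP (@TaggedDivision (line R) n J t)).
Qed.

Lemma is_HS2E Q F g A :
  is_HS2 Q F g A <-> @is_integral R (plane R) Q F (incr2 g) A.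
Proof.
split=> [H|/cvgrPdist_lt H e e0].
  apply/cvgrPdist_lt => e e0; have [gam gg gP] := H e e0.
  by exists gam => // P tP fP; rewrite distrC; exact: gP.
have [gam gg gP] := H e e0; exists gam => // n J t dJ fJ.
by rewrite distrC; exact: (gP (@TaggedDivision (plane R) n J t)).
Qed.

Lemma HS1_unique I v h A : ok1 I ->
  @is_integral R (line R) I v (incr1 h) A -> HS1 I v h = A.
Proof.
move=> oI hA; have : is_HS1 I v h (HS1 I v h).
  by apply: (@getPex _ (is_HS1 I v h)); exists A; apply/is_HS1E.
by move/is_HS1E/(is_integral_unique (@cousin_line R) oI); exact.
Qed.

Lemma HS2_unique Q F g A : ok2 Q ->
  @is_integral R (plane R) Q F (incr2 g) A -> HS2 Q F g = A.
Proof.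
move=> oQ hA; have : is_HS2 Q F g (HS2 Q F g).
  by apply: (@getPex _ (is_HS2 Q F g)); exists A; apply/is_HS2E.
by move/is_HS2E/(is_integral_unique (@cousin_plane R) oQ); exact.
Qed.

Lemma var1_bounded h : (var1 h < +oo)%E ->
  exists V : R, @variation_bounded R (line R) (whole1 R) (incr1 h) V.
Proof.
move=> vh; exists (fine (var1 h)) => n J tJ.
have : ((\sum_i `|incr1 h (J i)|)%:E <= var1 h)%E.
  by apply: ereal_sup_ubound; exists n, J.
by move: vh; case: (var1 h).
Qed.

Lemma var12_bounded g : (var12 g < +oo)%E ->
  exists V : R, @variation_bounded R (plane R) (whole2 R) (incr2 g) V.
Proof.
move=> vg; exists (fine (var12 g)) => n J tJ.
have : ((\sum_i `|incr2 g (J i)|)%:E <= var12 g)%E.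
  by apply: ereal_sup_ubound; exists n, J.
by move: vg; case: (var12 g).
Qed.

(** * Exchanging the two variables *)

Definition swap {T U : Type} (p : T * U) := (p.2, p.1).

Lemma tiling_swap (T : finType) Q (P : T -> itv2 R) :
  @tiling (plane R) T Q P -> @tiling (plane R) T (swap Q) (swap \o P).
Proof.
move=> tP; have [okP cP thP] := tP; split=> [i| |i j ij].
- by have [] := okP i.
- apply/seteqP; split=> [[x y] [i _ [Px Py]]|[x y] [Qx Qy]].
    by have [] : @pts (plane R) Q (y, x) by rewrite -cP; exists i.
  have : @pts (plane R) Q (y, x) by split.
  by rewrite -cP => -[i _ [? ?]]; exists i => //; split.
- apply/null2P => -[x y]; have /null2P/(_ (y, x)) := thP _ _ ij.
  by apply: contra; rewrite /hop2 /= => /andP[/andP[-> ->] /andP[-> ->]].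
Qed.

Lemma incr2_swap g Q : incr2 (g \o swap) Q = incr2 g (swap Q).
Proof. by case: Q => -[a b] [c d]; rewrite /incr2/=; ring. Qed.

Lemma swap_continuous : continuous (@swap (\bar R) (\bar R)).
Proof. by move=> [x y] A [[B C] /= [nB nC] BC]; exists (C, B) => // -[s t] [? ?]; exact: BC. Qed.

Lemma variation_bounded_swap g (V : R) :
  @variation_bounded R (plane R) (whole2 R) (incr2 g) V ->
  @variation_bounded R (plane R) (whole2 R) (incr2 (g \o swap)) V.
Proof.
move=> gV n P /tiling_swap /gV; rewrite (eq_bigr (fun i => `|incr2 (g \o swap) (P i)|))//.
by move=> i _; rewrite incr2_swap.
Qed.

Lemma is_integral_swap Q F g A : @is_integral R (plane R) Q F (incr2 g) A ->
  @is_integral R (plane R) (swap Q) (F \o swap) (incr2 (g \o swap)) A.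
Proof.
move=> /cvgrPdist_lt H; apply/cvgrPdist_lt => e e0.
have [gam gg gP] := H e e0.
exists (fun z => swap @^-1` gam (swap z)).
  move=> [x y]; have [og gz fz] := gg (y, x); split=> //.
    by apply: open_comp => // z _; exact: swap_continuous.
  move=> [[a b] _ [ax bY]] [s t] gst.
  have [|[c d] _ [ct ds]] := fz _ _ gst.
    by exists (b, a) => //; rewrite /fin2 /= ax bY.
  by exists (d, c) => //; rewrite /fin2 /= ct ds.
move=> P tP fP.
have := gP (@TaggedDivision (plane R) _ (swap \o dcell P) (swap \o dtag P)).
rewrite /riemann /= => /(_ _ _); rewrite /riemann.
under [in X in _ -> X]eq_bigr do rewrite incr2_swap.
apply.
  have := tiling_swap tP; by case: Q {H gP tP}.
move=> i; have [[? ?] s] := fP i; split=> [|[x y] [? ?]]; first by split.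
exact: (s (y, x)).
Qed.

Lemma HS2_swap Q F g : ok2 Q -> HS2_integrable Q F g ->
  HS2 (swap Q) (F \o swap) (g \o swap) = HS2 Q F g.
Proof.
move=> oQ [A /is_HS2E hA]; rewrite (HS2_unique oQ hA); apply: HS2_unique.
  by case: oQ.
exact: is_integral_swap.
Qed.

(** * Bounds for functions of bounded Hardy-Krause variation *)

(** One constant for the function, its variation in each variable along every
    line, and its planar variation: all that the estimates see of [g]. *)
Definition hk_bounded g (C : R) := [/\ forall z, `|g z| <= C,
  forall y, @variation_bounded R (line R) (whole1 R) (incr1 (fun x => g (x, y))) C,
  forall x, @variation_bounded R (line R) (whole1 R) (incr1 (fun y => g (x, y))) C &
  @variation_bounded R (plane R) (whole2 R) (incr2 g) C].

Lemma tiling_cylinder (T : finType) J K (L : T -> itv1 R) : ok1 K ->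
  @tiling (line R) T J L -> @tiling (plane R) T (J, K) (fun i => (L i, K)).
Proof.
move=> oK [okL cL thL]; split=> [i| |i j ij]; first by split=> //; exact: okL.
  apply/seteqP; split=> [[x y] [i _ [Lx Ky]]|[x y] [/= Jx Ky]].
    split=> //=; rewrite -[segment J]/(@pts (line R) J) -cL; by exists i.
  move: Jx; rewrite -[segment J]/(@pts (line R) J) -cL => -[i _ Lx].
  by exists i.
apply/null2P => -[x y]; have /null1P/(_ x) := thL _ _ ij.
by apply: contra => /andP[/andP[/= -> _] /andP[/= -> _]].
Qed.

(** The increment of a section at height [y] differs from the one at height
    [y0] by the increment over the rectangle between the two heights. *)
Lemma variation_section g (V V1 : R) y0 y :
  @variation_bounded R (plane R) (whole2 R) (incr2 g) V ->
  @variation_bounded R (line R) (whole1 R) (incr1 (fun x => g (x, y0))) V1 ->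
  @variation_bounded R (line R) (whole1 R) (incr1 (fun x => g (x, y))) (V1 + V).
Proof.
move=> gV g1 n J tJ.
pose K : itv1 R := (mine y0 y, maxe y0 y).
have oK : ok1 K by rewrite /ok1 /= ge_min le_max lexx.
have okw : ok2 (whole1 R, K) by split=> //; exact: leey.
have := variation_bounded_plane okw gV (tiling_cylinder oK tJ).
move=> /(lerD (g1 _ _ tJ)); apply: le_trans.
apply: (@le_trans _ _ (\sum_i (`|incr1 (fun x => g (x, y0)) (J i)| +
    `|incr2 g (J i, K)|))); last by rewrite big_split.
apply: ler_sum => i _; rewrite incr2E /K.
pose D t := incr1 (fun x => g (x, t)) (J i).
have -> : `|incr1 D (mine y0 y, maxe y0 y)| = `|D y - D y0|.
  by rewrite /incr1 /=; case: leP => _ //; rewrite distrC.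
by have := ler_normD (D y0) (D y - D y0); rewrite addrC subrK.
Qed.

Lemma variation_ge h (V : R) a b : (a <= b)%E ->
  @variation_bounded R (line R) (whole1 R) (incr1 h) V -> `|h b - h a| <= V.
Proof.
move=> ab hV; have := variation_bounded_line (_ : ok1 (a, b)) hV.
move=> /(_ ab) /(_ _ _ (tiling_single (ab : @ok (line R) (a, b)))).
by rewrite big_ord1.
Qed.

Lemma hk_bounded_swap g C : hk_bounded g C -> hk_bounded (g \o swap) C.
Proof.
by move=> [g0 g1 g2 g12]; split=> // [z|]; [exact: g0|exact: variation_bounded_swap].
Qed.

(** Any point is reached from (x0, y0) by moving at height y0 and then
    vertically, so the variations also bound [g] itself. *)
Lemma HKBV_bounded g : HKBV g -> exists C : R, hk_bounded g C.
Proof.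
move=> [/var12_bounded[V gV] [x0 [y0 [/var1_bounded[V1 gV1] /var1_bounded[V2 gV2]]]]].
have g1 y := variation_section y gV gV1.
have g2 x : @variation_bounded R (line R) (whole1 R) (incr1 (fun y => g (x, y))) (V2 + V).
  exact: (@variation_section (g \o swap) V V2 x0 x (variation_bounded_swap gV) gV2).
have dist h (W : R) a b : @variation_bounded R (line R) (whole1 R) (incr1 h) W ->
    `|h b - h a| <= W.
  by move=> hW; case: (leP a b) => [|/ltW] ab; [|rewrite distrC]; exact: variation_ge hW.
have V0 : 0 <= V.
  have okw : @ok (plane R) (whole2 R) by split; exact: leey.
  by apply: le_trans (gV _ _ (tiling_single okw)); exact: sumr_ge0.
have V10 : 0 <= V1 := le_trans (normr_ge0 _) (dist _ _ -oo%E -oo%E gV1).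
have V20 : 0 <= V2 := le_trans (normr_ge0 _) (dist _ _ -oo%E -oo%E gV2).
pose C := `|g (x0, y0)| + V1 + V2 + V + V.
have N0 := normr_ge0 (g (x0, y0)).
exists C; split.
- move=> [x y]; have := dist _ _ y0 y (g2 x); have := dist _ _ x0 x (g1 y0).
  have := ler_normD (g (x0, y0)) (g (x, y0) - g (x0, y0)).
  have := ler_normD (g (x, y0)) (g (x, y) - g (x, y0)).
  rewrite ![_ + (_ - _)]addrC !subrK /= /C; lra.
- by move=> y; apply: (variation_bounded_le _ (g1 y)); rewrite /C; lra.
- by move=> x; apply: (variation_bounded_le _ (g2 x)); rewrite /C; lra.
- by apply: (variation_bounded_le _ gV); rewrite /C; lra.
Qed.

(** * Existence of the integrals and the increments of Phi *)

Lemma continuous_section1 F y : continuous F -> continuous (fun x => F (x, y)).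
Proof.
move=> cF x A /(cF (x, y))[[B C] /= [nB nC] BC]; apply: filterS nB => t Bt.
exact: (BC (t, y) (conj Bt (nbhs_singleton nC))).
Qed.

Lemma continuous_section2 F x : continuous F -> continuous (fun y => F (x, y)).
Proof.
move=> cF y A /(cF (x, y))[[B C] /= [nB nC] BC]; apply: filterS nC => t Ct.
exact: (BC (x, t) (conj (nbhs_singleton nB) Ct)).
Qed.

Lemma HS1_is_integral I v h (C : R) : ok1 I -> continuous v ->
  @variation_bounded R (line R) (whole1 R) (incr1 h) C ->
  @is_integral R (line R) I v (incr1 h) (HS1 I v h).
Proof.
move=> oI cv hC.
have [A hA] := is_integral_exists (@cousin_line R) oI (incr1_additive h)
  (variation_bounded_line oI hC) cv.
by rewrite (HS1_unique oI hA).
Qed.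

Lemma HS2_is_integral Q F g (C : R) : ok2 Q -> continuous F ->
  @variation_bounded R (plane R) (whole2 R) (incr2 g) C ->
  @is_integral R (plane R) Q F (incr2 g) (HS2 Q F g).
Proof.
move=> oQ cF gC.
have [A hA] := is_integral_exists (@cousin_plane R) oQ (incr2_additive g)
  (variation_bounded_plane oQ gC) cF.
by rewrite (HS2_unique oQ hA).
Qed.

(** With F = G + v and v (s, t) = F (x, t): additivity in the domain cancels
    the parts over (-oo, x), the integral of [v] in the first variable is an
    integral of a constant, and the planar integral of [v] is the difference
    of the one-variable integrals of [v] against g (x', .) and g (x, .).  The
    contributions of [v] then cancel, which leaves four terms in [G]. *)
Lemma Phi_increment F g x x' y (C e : R) : continuous F -> hk_bounded g C ->
  (x <= x')%E -> 0 <= e ->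
  (forall s t, (x <= s <= x')%E -> `|F (s, t) - F (x, t)| <= e) ->
  `|Phi F g (x', y) - Phi F g (x, y)| <= e * C *+ 4.
Proof.
move=> cF [g0 g1 g2 g12] xx' e0 Fe.
have oX : ok1 (x, x') := xx'.
have okN (z : \bar R) : ok1 (-oo%E, z) := leNye z.
have o2X : ok2 ((x, x'), (-oo%E, y)) := conj oX (okN y).
pose v t := F (x, t); pose G z := F z - v z.2.
have cv : continuous v by exact: continuous_section2.
have cv2 : continuous (fun z : \bar R * \bar R => v z.2).
  by by move=> z; apply: (continuous_comp (f := snd)); [exact: cvg_snd|exact: cv].
have cG : continuous G by move=> z; apply: cvgB; [exact: cF|exact: cv2].
have i1 y0 I : ok1 I -> @is_integral R (line R) I (fun s => F (s, y0))
    (incr1 (fun s => g (s, y0))) (HS1 I (fun s => F (s, y0)) (fun s => g (s, y0))).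
  by move=> oI; apply: HS1_is_integral (g1 y0) => //; exact: continuous_section1.
have iG1 : @is_integral R (line R) (x, x') (fun s => G (s, y))
    (incr1 (fun s => g (s, y))) (HS1 (x, x') (fun s => G (s, y)) (fun s => g (s, y))).
  by apply: HS1_is_integral (g1 y) => //; exact: continuous_section1.
have i2 (u : \bar R -> R) : continuous u -> forall x0, @is_integral R (line R) (-oo%E, y) u
    (incr1 (fun t => g (x0, t))) (HS1 (-oo%E, y) u (fun t => g (x0, t))).
  by move=> cu x0; exact: HS1_is_integral (g2 x0).
have i12 (u : \bar R * \bar R -> R) Q : continuous u -> ok2 Q ->
    @is_integral R (plane R) Q u (incr2 g) (HS2 Q u g).
  by move=> cu oQ; exact: HS2_is_integral g12.
have adj := adjoin_line (leNye x) xx'.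
have Ea : HS1 (-oo%E, x') (fun s => F (s, y)) (fun s => g (s, y)) = _ :=
  is_integral_adjoin (@cousin_line R) (okN x) oX adj
    (i1 y _ (okN x)) (i1 y _ oX) (i1 y _ (okN x')).
have o2 z : @ok (plane R) ((-oo%E, z), (-oo%E, y)) := conj (okN z) (okN y).
have Eb : HS2 ((-oo%E, x'), (-oo%E, y)) F g = _ :=
  is_integral_adjoin (@cousin_plane R) (o2 x) (o2X : @ok (plane R) _)
    (adjoin_plane1 (-oo%E, y) adj) (i12 F _ cF (o2 x))
    (i12 F _ cF o2X) (i12 F _ cF (o2 x')).
have FG : F = (fun z => G z + v z.2) by apply/funext => z; rewrite subrK.
have Ec : HS2 ((x, x'), (-oo%E, y)) F g =
    HS2 ((x, x'), (-oo%E, y)) G g + HS2 ((x, x'), (-oo%E, y)) (fun z => v z.2) g.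
  rewrite {1}FG; apply: HS2_unique => //.
  by apply: is_integralD; exact: i12.
have Ed : HS2 ((x, x'), (-oo%E, y)) (fun z => v z.2) g =
    HS1 (-oo%E, y) v (fun t => g (x', t)) - HS1 (-oo%E, y) v (fun t => g (x, t)).
  apply: (is_integral_snd oX (okN y) (i12 _ _ cv2 o2X)).
  rewrite (_ : (fun L => _) = (fun L => incr1 (fun t => g (x', t)) L -
      incr1 (fun t => g (x, t)) L)).
    by apply: is_integralB_weight; exact: i2.
  by apply/funext => L; rewrite incr2E /incr1 /=; ring.
have Ee : HS1 (-oo%E, y) (fun t => F (x', t)) (fun t => g (x', t)) =
    HS1 (-oo%E, y) (fun t => G (x', t)) (fun t => g (x', t)) +
    HS1 (-oo%E, y) v (fun t => g (x', t)).
  rewrite {1}FG; apply: HS1_unique => //.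
  by apply: is_integralD; apply: i2 => //; exact: continuous_section2.
have Ef : HS1 (x, x') (fun s => F (s, y)) (fun s => g (s, y)) =
    HS1 (x, x') (fun s => G (s, y)) (fun s => g (s, y)) +
    F (x, y) * (g (x', y) - g (x, y)).
  rewrite {1}FG; apply: HS1_unique => //.
  apply: is_integralD => //.
  exact: (is_integral_cst (c := F (x, y)) (oX : @ok (line R) _)
    (@incr1_additive R (fun s => g (s, y)))).
rewrite /Phi /= Ea Eb Ec Ed Ee Ef.
rewrite (_ : _ - _ = (F (x', y) - F (x, y)) * g (x', y)
  - HS1 (x, x') (fun s => G (s, y)) (fun s => g (s, y))
  - HS1 (-oo%E, y) (fun t => G (x', t)) (fun t => g (x', t))
  + HS2 ((x, x'), (-oo%E, y)) G g); last by rewrite /v; ring.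
have Ge s t : (x <= s <= x')%E -> `|G (s, t)| <= e by exact: Fe.
have b0 : `|(F (x', y) - F (x, y)) * g (x', y)| <= e * C.
  by rewrite normrM ler_pM// Fe// xx' lexx.
have b1 := is_integral_le (@cousin_line R) oX e0 (_ : forall z, _ -> _ <= _)
  (variation_bounded_line oX (g1 y)) iG1.
have b2 := is_integral_le (@cousin_line R) (okN y) e0 (_ : forall z, _ -> _ <= _)
  (variation_bounded_line (okN y) (g2 x')) (i2 _ (continuous_section2 cG (x := x')) x').
have b3 := is_integral_le (@cousin_plane R) o2X e0 (_ : forall z, _ -> _ <= _)
  (variation_bounded_plane o2X g12) (i12 _ _ cG o2X).
have {}b1 := b1 (fun s => Ge s y).
have {}b2 := b2 (fun t _ => Ge x' t (introT andP (conj xx' (lexx x')))).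
have {}b3 := b3 (fun '(s, t) zX => Ge s t zX.1).
rewrite (mulrS _ 3) (mulrS _ 2) mulr2n.
apply: le_trans (ler_normD _ _) _; rewrite addrC lerD//.
apply: le_trans (ler_normB _ _) _; rewrite addrC lerD//.
by apply: le_trans (ler_normB _ _) _; rewrite lerD.
Qed.

(** * Continuity of Phi *)

Lemma Phi_swap F g (C : R) x y : continuous F -> hk_bounded g C ->
  Phi (F \o swap) (g \o swap) (y, x) = Phi F g (x, y).
Proof.
move=> cF [_ _ _ g12].
have oQ : ok2 ((-oo%E, x), (-oo%E, y)) by split; exact: leNye.
have hI : HS2_integrable ((-oo%E, x), (-oo%E, y)) F g.
  by exists (HS2 ((-oo%E, x), (-oo%E, y)) F g); apply/is_HS2E; exact: HS2_is_integral g12.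
by rewrite /Phi /= -(HS2_swap oQ hI) /swap /=; ring.
Qed.

(** Order convex sets form a basis of neighbourhoods in the extended line. *)
Lemma near_between (x : \bar R) (N : set (\bar R)) : nbhs x N ->
  \forall y \near x, forall s, (mine x y <= s <= maxe x y)%E -> N s.
Proof.
move=> nN.
have up : \forall y \near x, forall s, (x <= s <= y)%E -> N s.
  have [xE|xy] := eqVneq x +oo%E.
    apply: nearW => y s /andP[]; rewrite xE leye_eq => /eqP -> _.
    by rewrite -xE; exact: nbhs_singleton.
  have ltxy : (x < +oo)%E by rewrite lt_neqAle xy leey.
  have [q xq qN] := nbhs_right_segment nN ltxy.
  apply: filterS (open_ereal_lt' xq) => y yq s /andP[xs sy].
  by apply: qN; rewrite xs (le_trans sy (ltW yq)).
have down : \forall y \near x, forall s, (y <= s <= x)%E -> N s.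
  have [xE|xy] := eqVneq x -oo%E.
    apply: nearW => y s /andP[_]; rewrite xE leeNy_eq => /eqP ->.
    by rewrite -xE; exact: nbhs_singleton.
  have ltxy : (-oo < x)%E by rewrite lt_neqAle eq_sym xy leNye.
  have [q qx qN] := nbhs_left_segment nN ltxy.
  apply: filterS (open_ereal_gt' qx) => y qy s /andP[ys sx].
  by apply: qN; rewrite sx (le_trans (ltW qy) ys).
apply: filterS2 up down => y upy downy s.
by case: (leP x y) => xy; [exact: upy|exact: downy].
Qed.

(** This is the tube lemma: the other variable ranges over a compact set. *)
Lemma near_uniform F x (e : R) : continuous F -> 0 < e ->
  \forall s \near x, forall t, `|F (s, t) - F (x, t)| < e.
Proof.
move=> cF e0; have e2 : 0 < e / 2 by rewrite divr_gt0.
have /compact_near_coveringP cov := @ereal_segment_compact R (whole1 R).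
have : \forall s \near x, segment (whole1 R) `<=`
    (fun t => `|F (s, t) - F (x, t)| < e).
  apply: cov => t _.
  have /cvgrPdist_lt/(_ _ e2)[[A B] /= [nA nB] AB] := cF (x, t).
  exists (B, A) => // -[t' s] [/= Bt As].
  have := AB (s, t') (conj As Bt); have := AB (x, t') (conj (nbhs_singleton nA) Bt).
  move=> /= h1 h2; rewrite (_ : _ - _ = (F (x, t) - F (x, t')) - (F (x, t) - F (s, t'))); last by ring.
  by rewrite (le_lt_trans (ler_normB _ _))// [e]splitr ltrD.
by apply: filterS => s Fs t; apply: Fs; rewrite segmentE leNye leey.
Qed.

(** [Phi_increment] compares with the value of [F] at the left endpoint, which
    is [x'] when x' < x; going through the value at [x] doubles [d]. *)
Lemma near_Phi1 F g (C e : R) x : continuous F -> hk_bounded g C -> 0 < e ->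
  \forall x' \near x, forall y, `|Phi F g (x, y) - Phi F g (x', y)| < e.
Proof.
move=> cF hg e0; have [/(_ (x, x)) C0 _ _ _] := hg.
have {}C0 : 0 <= C by exact: le_trans C0.
(* Four terms, twice the oscillation, and C + 1 in case C = 0. *)
pose d := e / ((C + 1) *+ 8).
have d0 : 0 < d by rewrite divr_gt0// pmulrn_lgt0// ltr_wpDl.
apply: filterS (near_between (near_uniform x cF d0)) => x' dx' y.
have small a b : (a <= b)%E -> (forall s, (a <= s <= b)%E ->
    forall t, `|F (s, t) - F (x, t)| < d) -> `|Phi F g (b, y) - Phi F g (a, y)| < e.
  move=> ab abd.
  apply: le_lt_trans (Phi_increment y cF hg ab (_ : 0 <= d + d) _) _.
  - by rewrite addr_ge0// ltW.
  - move=> s t asb; rewrite (_ : _ - _ =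
      (F (s, t) - F (x, t)) - (F (a, t) - F (x, t))); last by ring.
    by rewrite (le_trans (ler_normB _ _))// lerD// ltW// abd ?lexx.
  - rewrite (_ : e = (d + d) * (C + 1) *+ 4); last first.
      by rewrite /d; field; rewrite gt_eqF// ltr_wpDl.
    by rewrite ltrMn2r/= ltr_pM2l ?addr_gt0// ltrDl.
move: dx'; case: (leP x x') => [|/ltW] xx' dx'; last exact: small.
by rewrite distrC; exact: small.
Qed.

Lemma Phi_continuous F g (C : R) : continuous F -> hk_bounded g C ->
  continuous (Phi F g).
Proof.
move=> cF hg [x y]; apply/cvgrPdist_lt => e e0.
have e2 : 0 < e / 2 by rewrite divr_gt0.
have cFs : continuous (F \o swap).
  by move=> z; apply: continuous_comp; [exact: swap_continuous|exact: cF].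
exists ([set x' | forall y, `|Phi F g (x, y) - Phi F g (x', y)| < e / 2],
  [set y' | forall x, `|Phi (F \o swap) (g \o swap) (y, x) -
                        Phi (F \o swap) (g \o swap) (y', x)| < e / 2]).
  split; first exact: near_Phi1 hg e2.
  exact: near_Phi1 (hk_bounded_swap hg) e2.
move=> [x' y'] [hx hy].
have h1 : `|Phi F g (x, y') - Phi F g (x', y')| < e / 2 := hx y'.
have h2 : `|Phi F g (x, y) - Phi F g (x, y')| < e / 2.
  by rewrite -!(Phi_swap _ _ cF hg); exact: hy.
rewrite (_ : _ - _ = (Phi F g (x, y) - Phi F g (x, y')) +
  (Phi F g (x, y') - Phi F g (x', y'))); last by ring.
by rewrite (le_lt_trans (ler_normD _ _))// [e]splitr ltrD.
Qed.

(** * Vanishing of Phi on the edges at -oo *)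

Lemma HS1_degenerate z v h : HS1 (z, z) v h = 0.
Proof.
apply: HS1_unique; first exact: lexx.
apply: is_integral_empty (incr1_additive h) _; first exact: lexx.
by move=> p; apply/negP => /andP[/lt_le_trans h1 /h1]; rewrite ltxx.
Qed.

Lemma HS1_zero I v h : ok1 I -> (forall t, v t = 0) ->
  HS1 I v h = 0.
Proof.
move=> oI v0; apply: HS1_unique => //; apply: cvg_near_cst.
by apply: near_division => P _ _; rewrite /riemann big1// => i _; rewrite v0 mul0r.
Qed.

Lemma HS2_degenerate Q F g : ok2 Q -> (forall z, ~~ hop2 Q z) -> HS2 Q F g = 0.
Proof.
move=> oQ nQ; apply: HS2_unique => //.
exact: is_integral_empty (incr2_additive g) nQ.
Qed.

Lemma Phi_Bc F g (C : R) : hk_bounded g C -> Bc F -> Bc (Phi F g).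
Proof.
move=> hg [cF F0]; split=> [|s]; first exact: Phi_continuous hg.
have hop0 (p : \bar R) : hop1 (-oo%E, -oo%E) p = false :> bool.
  by apply/negP => /andP[/lt_le_trans h1 /h1]; rewrite ltxx.
split; rewrite /Phi.
  rewrite HS1_degenerate HS1_zero; [|exact: leNye|by move=> t; case: (F0 t)].
  rewrite HS2_degenerate; first by rewrite (F0 s).1 mul0r !subr0 addr0.
    by split; exact: leNye.
  by move=> z; rewrite /hop2 /= hop0.
rewrite HS1_degenerate HS1_zero; [|exact: leNye|by move=> t; case: (F0 t)].
rewrite HS2_degenerate; first by rewrite (F0 s).2 mul0r !subr0 addr0.
  by split; exact: leNye.
by move=> z; rewrite /hop2 /= hop0 andbF.
Qed.

End phi.

Theorem proposition7p3 (R : realType) (F g : \bar R * \bar R -> R)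
    (f : functional R) (hF : continuous F) (hf : f = d12 F) (hg : HKBV g) :
  [/\ forall x y : \bar R,
        [/\ HS1_integrable (-oo%E, x) (fun s => F (s, y)) (fun s => g (s, y)),
            HS1_integrable (-oo%E, y) (fun t => F (x, t)) (fun t => g (x, t)) &
            HS2_integrable ((-oo%E, x), (-oo%E, y)) F g],
      continuous (Phi F g) &
      Bc F -> Bc (Phi F g) /\ Ac (d12 (Phi F g))].
Proof.
have [C hC] := HKBV_bounded hg; have [_ g1 g2 g12] := hC.
split=> [x y| |bF].
- have ok_ray (z : \bar R) : ok1 (-oo%E, z) := leNye z.
  split.
  + exists (HS1 (-oo%E, x) (fun s => F (s, y)) (fun s => g (s, y))); apply/is_HS1E.
    by apply: HS1_is_integral (g1 y) => //; exact: continuous_section1.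
  + exists (HS1 (-oo%E, y) (fun t => F (x, t)) (fun t => g (x, t))); apply/is_HS1E.
    by apply: HS1_is_integral (g2 x) => //; exact: continuous_section2.
  + exists (HS2 ((-oo%E, x), (-oo%E, y)) F g); apply/is_HS2E.
    by apply: HS2_is_integral g12 => //; split; exact: ok_ray.
- exact: Phi_continuous hC.
- have bPhi := Phi_Bc hC bF.
  by split=> //; exists (Phi F g).
Qed.
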